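(* For all non-negative integers $x,y,z,a$, the number of lozenge tilings of the region $\mathcal{R}_{x,y,z}(a)$ equals $P_1(x,y,z,a)$.
   Context: Triangular lattice with horizontal lattice lines. The regions considered are pentagonal regions bounded by a horizontal northern side, a northeastern side and a western side each following a zig-zag lattice path, a straight southeastern side, and a horizontal southern side (so that for such a pentagon with northern side $x$ and southeastern side $n$, the northeastern and western zig-zag sides have length $n$ and the southern side has length $x+n-1$). $\mathcal{R}_{x,y,z}(a)$ is obtained as follows: take such a pentagonal region whose northern, northeastern, southeastern, southern and western sides have lengths $x,\ y+z+2a,\ y+z,\ x+y+z+3a-1,\ y+z+a$; remove the $(y+1)$-st through $(y+a)$-th up-pointing unit triangles on the western side (counting from top to bottom); then remove the lozenges forced by this removal, producing a semi-triangular hole on the western side. Pochhammer: $(x)_n=x(x+1)\cdots(x+n-1)$ ($n>0$), $(x)_0=1$, $(x)_{-n}=1/((x-1)\cdots(x-n))$. Skipped Pochhammer: $[x]_n=x(x+2)\cdots(x+2n-2)$ ($n>0$), $[x]_0=1$, $[x]_n=1/((x-2)(x-4)\cdots(x+2n))$ ($n<0$). \begin{align*} P_1(x,y,z,a)&=\frac{1}{2^{y+z}}\prod_{i=1}^{y+z}\frac{(2x+6a+2i)_i[2x+6a+4i+1]_{i-1}}{(i)_i[2x+6a+2i+1]_{i-1}}\\ &\times\prod_{i=1}^{a}\frac{(z+i)_{y+a-2i+1}(x+y+2z+2a+2i)_{2y+2a-4i+2}(x+3i-2)_{y-i+1}(x+3y+2i-1)_{i-1}}{(i)_y(y+2z+2i-1)_{y+2a-4i+3}(2z+2i)_{y+2a-4i+1}(x+y+z+2a+i)_{y+a-2i+1}}.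 \end{align*} *)

(* Defs.v *)
From mathcomp Require Import all_boot all_order all_algebra.
Set Implicit Arguments. Unset Strict Implicit. Unset Printing Implicit Defensive.
Import GRing.Theory Num.Theory.

(* Coordinates on the triangular lattice with horizontal lattice lines.     *)
(* A unit triangle is a pair (r, t) : nat * nat where                       *)
(*   r = index of the horizontal strip (row) containing it, counted from    *)
(*       the bottom of the region (row r lies between lines r and r+1);     *)
(*   t = horizontal position of its centre, in units of half a side length. *)
(* Within a row consecutive t alternate between up- and down-pointing       *)
(* triangles; we fix the parity: (r, t) points up iff r + t is odd.          *)
(* Two unit triangles share an edge iff they are horizontal neighbours in   *)
(* the same row (t and t+1), or an up-pointing triangle (r, t) and the      *)
(* down-pointing triangle (r-1, t) just below its horizontal base.          *)

Definition tri := (nat * nat)%type.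

Definition is_up (p : tri) : bool := odd (p.1 + p.2).

(* [lozenge u d]: u is up-pointing, d is down-pointing, and they share an
   edge; the lozenge is the union of u and d (each lozenge is represented
   exactly once, by the pair (up, down)). *)
Definition lozenge (u d : tri) : bool :=
  [&& is_up u, ~~ is_up d &
      ((u.1 == d.1) && ((u.2 == d.2.+1) || (d.2 == u.2.+1)))
      || ((u.1 == d.1.+1) && (u.2 == d.2))].

(* A finite box of triangles 'I_hb * 'I_nb, used only to get a finType. *)
Definition box (hb nb : nat) := ('I_hb * 'I_nb)%type.
Definition pt hb nb (q : box hb nb) : tri := (nat_of_ord q.1, nat_of_ord q.2).

(* A lozenge tiling of the region S (all of whose triangles lie in the box)
   is a set T of lozenges contained in S such that every unit triangle of S
   lies in exactly one lozenge of T. *)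
Definition is_tiling hb nb (S : pred tri) (T : {set box hb nb * box hb nb}) : bool :=
  [forall l in T, [&& lozenge (pt l.1) (pt l.2), S (pt l.1) & S (pt l.2)]] &&
  [forall q : box hb nb,
     S (pt q) ==> (#|[set l in T | (l.1 == q) || (l.2 == q)]| == 1)%N].

Definition ntilings hb nb (S : pred tri) : nat :=
  #|[set T : {set box hb nb * box hb nb} | is_tiling S T]|.

(* The pentagon with northern side x, northeastern zig-zag side ne,         *)
(* straight southeastern side se, horizontal southern side, and western     *)
(* vertical zig-zag side (ne + se)/2 (used with ne + se even).  It has      *)
(* ne + se rows.                                                            *)
(*  * West: vertical zig-zag, i.e. t >= 0 in every row; the leftmost        *)
(*    triangles alternate up/down, the top-left one pointing up (its apex   *)
(*    is the NW corner); so there is one western up-triangle per two rows.  *)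
(*  * North: the top row is bounded above by x unit edges (the tops of its   *)
(*    x down-pointing triangles), i.e. the top row is 0 <= t <= 2x.         *)
(*  * Northeast: zig-zag of length ne made of ne edges going down-right     *)
(*    (one per row, the rightmost triangle of each of the top ne rows is    *)
(*    up-pointing) joined by ne-1 horizontal unit edges; hence the right    *)
(*    end moves right by 3 half-units per row going down.                   *)
(*  * Southeast: straight side of length se going down-left (one edge per   *)
(*    row in the bottom se rows, rightmost triangles point down).           *)
(*  * South: horizontal; for ne = y+z+2a, se = y+z it has length            *)
(*    x+y+z+3a-1 (= number of up-triangles in the bottom row).              *)
Definition pentagon (x ne se : nat) (p : tri) : bool :=
  let r := p.1 in let t := p.2 in
  (r < ne + se) &&
  (if r < se then t + se + 2 <= 2 * x + 3 * ne + r
   else t + 3 * r + 3 <= 2 * x + 3 * (ne + se)).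

(* The western up-pointing triangles are (r, 0) with r odd.  Counting from
   top to bottom in a region with hgt rows (hgt even), (r, 0) is number
   (hgt + 1 - r) / 2. *)
Definition west_up_rank (hgt : nat) (p : tri) : nat := (hgt + 1 - p.1) %/ 2.

(* R_{x,y,z}(a) before removal of forced lozenges: the pentagon with sides
   x, y+z+2a, y+z, x+y+z+3a-1, y+z+a minus the (y+1)-st through (y+a)-th
   up-pointing unit triangles on its western side (counted top to bottom).
   Removing the lozenges forced by this removal does not change the number
   of lozenge tilings. *)
Definition Rregion (x y z a : nat) (p : tri) : bool :=
  pentagon x (y + z + 2 * a) (y + z) p &&
  ~~ [&& p.2 == 0, is_up p &
         y < west_up_rank (2 * (y + z + a)) p <= y + a].

Definition Rhb (x y z a : nat) : nat := 2 * (y + z + a).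
Definition Rnb (x y z a : nat) : nat := 2 * x + 3 * (2 * (y + z + a)) + 1.

Definition M_R (x y z a : nat) : nat :=
  ntilings (Rhb x y z a) (Rnb x y z a) (Rregion x y z a).

Local Open Scope ring_scope.

Definition poch (x : rat) (n : int) : rat :=
  match n with
  | Posz k => \prod_(j < k) (x + j%:R)
  | Negz k => (\prod_(j < k.+1) (x - j.+1%:R))^-1
  end.

Definition spoch (x : rat) (n : int) : rat :=
  match n with
  | Posz k => \prod_(j < k) (x + (2 * j)%:R)
  | Negz k => (\prod_(j < k.+1) (x - (2 * j.+1)%:R))^-1
  end.

Definition P1 (x y z a : nat) : rat :=
  let X : rat := x%:R in let Y : rat := y%:R in
  let Z : rat := z%:R in let A : rat := a%:R in
  let yi : int := y%:Z in let ai : int := a%:Z in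
  ((2 ^+ (y + z))^-1 *
   \prod_(1 <= i < (y + z).+1)
     (poch (2*X + 6*A + 2*i%:R) i%:Z * spoch (2*X + 6*A + 4*i%:R + 1) (i%:Z - 1)
      / (poch i%:R i%:Z * spoch (2*X + 6*A + 2*i%:R + 1) (i%:Z - 1))))
  * \prod_(1 <= i < a.+1)
     (poch (Z + i%:R) (yi + ai - 2 * i%:Z + 1)
      * poch (X + Y + 2*Z + 2*A + 2*i%:R) (2*yi + 2*ai - 4 * i%:Z + 2)
      * poch (X + 3*i%:R - 2) (yi - i%:Z + 1)
      * poch (X + 3*Y + 2*i%:R - 1) (i%:Z - 1)
      / (poch i%:R yi
         * poch (Y + 2*Z + 2*i%:R - 1) (yi + 2*ai - 4 * i%:Z + 3)
         * poch (2*Z + 2*i%:R) (yi + 2*ai - 4 * i%:Z + 1)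
         * poch (X + Y + Z + 2*A + i%:R) (yi + ai - 2 * i%:Z + 1))).

(* Main.v *)
Require Import Defs.
From mathcomp Require Import all_boot all_order all_algebra.
From mathcomp Require Import zify ring.
Set Implicit Arguments. Unset Strict Implicit. Unset Printing Implicit Defensive.

(* Let n = y + z, B = n + a and X = x + 3 B.  The lozenges crossing the
   diagonal lattice lines parallel to the southeastern side form n
   non-intersecting paths from that side to the n western up-pointing
   triangles that were not removed; reflecting in the northeastern zig-zag
   side, the number of tilings is the determinant of a matrix of differences
   of two binomial coefficients.  Row operations, which move the starting
   points of the paths back to the reflecting line, turn it into the
   determinant of the ballot numbers
     (q - p) (p + q - 1)! / (p! q!),  p = 2 j - 1 - i,  q = X - j - i,
   with 0 <= i < n and j in {1, .., z} u {z + a + 1, .., B}.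
   For fixed X these determinants satisfy a three-term Pluecker relation in
   (z, a, y), which reduces them to the case of consecutive columns; there,
   Dodgson condensation gives a product formula.  Both recurrences are checked
   on the closed forms by comparing the two products in each term. *)

(** * Perfect matchings, one vertex at a time *)

(** Exchanging the tails of crossing paths is avoided. The up-pointing triangles are matched one at
    a time, and a determinant with one row per path, attached to the current position of the path,
    is carried along; a step onto an occupied position contributes a repeated row, hence zero. Along
    a path the strip index [k] drops by one while the row [r] stays or grows by one. So [k + 2 r]
    changes by exactly one, which allows the reflection in the northeastern side, and [2 k + r]
    strictly decreases, so a path meets the western side only at its end and the removed triangles
    merely delete columns. In the ballot matrix [x] occurs only through [X]; for fixed [X], lowering
    [y + z + a] by one raises [x] by three, whence the shifts by 3 in [gapfactor_rec]. Both
    recurrences are instances of one three-term relation, proved when its leading determinant is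
    nonzero; the closed forms, products of factorials, double factorials and their inverses, provide
    this during the inductions. *)

Section Matchings.
Variables (T : finType) (adj : rel T).

Definition matching (us : seq T) (A : {set T}) (M : {set T * T}) : bool :=
  [forall l in M, [&& adj l.1 l.2, l.1 \in us & l.2 \in A]] &&
  [forall q, (q \in us) || (q \in A) ==>
     (#|[set l in M | (l.1 == q) || (l.2 == q)]| == 1)].

(** The expansion of the permanent of the adjacency matrix, row by row. The order of [us] is kept as
    data because the path argument depends on it. *)
Fixpoint nmatch (us : seq T) (A : {set T}) : nat :=
  if us is u :: us' then \sum_(d in A | adj u d) nmatch us' (A :\ d)
  else (A == set0).

Lemma card_cover1P (M : {set T * T}) (q : T) :
  reflect (exists2 l, l \in M /\ (l.1 == q) || (l.2 == q) &
             forall l', l' \in M -> (l'.1 == q) || (l'.2 == q) -> l' = l)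
          (#|[set l in M | (l.1 == q) || (l.2 == q)]| == 1).
Proof.
apply: (iffP cards1P) => [[l El]|[l [lM lq] lu]]; exists l.
- by have := set11 l; rewrite -El inE => /andP[].
- by move=> l' l'M l'q; apply/set1P; rewrite -El inE l'M.
- apply/setP=> l'; rewrite !inE; apply/andP/eqP => [[]|->//].
  exact: lu.
Qed.

(** Exact covering makes [(u, d)] the only edge of [M] that touches [u] or [d]. *)
Lemma matching_rem (u : T) (us : seq T) (A : {set T}) (d : T) (M : {set T * T}) :
  u \notin us -> u \notin A -> d \in A -> d \notin us -> {in us, forall q, q \notin A} ->
  (u, d) \in M -> adj u d ->
  matching (u :: us) A M = matching us (A :\ d) (M :\ (u, d)).
Proof.
move=> uus uA dA dus dis udM aud.
have ud : u != d by apply: contraNneq uA => ->.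
apply/andP/andP => -[/forall_inP ok /forallP ex]; split.
- apply/forall_inP => -[p q] /=; rewrite !inE => /andP[ne pqM].
  have /= /and3P[-> pus qA] := ok _ pqM; rewrite qA andbT /=.
  have := ex d; rewrite dA orbT /= => /card_cover1P[l [_ _]] ld.
  have := ex u; rewrite mem_head /= => /card_cover1P[l' [_ _]] lu.
  have E1 := ld (u, d) udM; rewrite /= eqxx orbT in E1.
  have E2 := lu (u, d) udM; rewrite /= eqxx in E2.
  have F1 := ld (p, q) pqM; have F2 := lu (p, q) pqM.
  rewrite /= in F1 F2; move: pus; rewrite inE => /orP[/eqP pu|->].
    by case/eqP: ne; rewrite F2 ?pu ?eqxx // -E2.
  rewrite andTb; apply: contraNneq ne => qd.
  by rewrite F1 ?qd ?eqxx ?orbT // -E1.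
- apply/forallP => q; apply/implyP => qq.
  have q1 : (q \in u :: us) || (q \in A).
    by move: qq; rewrite !inE => /orP[->|/andP[_ ->]]; rewrite ?orbT.
  have qd : q != d by move: qq => /orP[|]; [apply: contraTneq => ->|rewrite !inE => /andP[]].
  have qu : q != u.
    move: qq => /orP[|]; first by apply: contraTneq => ->.
    by rewrite !inE => /andP[_]; apply: contraTneq => ->.
  have := ex q; rewrite q1 /= => /card_cover1P[l [lM lq] lu].
  apply/card_cover1P; exists l; last by move=> l'; rewrite !inE => /andP[_]; apply: lu.
  split=> //; rewrite !inE lM andbT; apply: contraTneq lq => -> /=.
  by rewrite !(eq_sym _ q) (negPf qd) (negPf qu).
- apply/forall_inP => -[p q] pqM /=.
  have [[-> ->]|ne] := eqVneq (p, q) (u, d); first by rewrite aud dA mem_head.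
  have := ok (p, q); rewrite !inE ne pqM /= => /(_ isT)/and3P[-> -> /andP[_ ->]].
  by rewrite orbT.
- apply/forallP => q; apply/implyP => qq.
  have okl l : l \in M -> l != (u, d) -> [&& l.1 \in us, l.2 \in A & l.2 != d].
    move=> lM ne; have := ok l; rewrite !inE ne lM => /(_ isT)/and3P[_ -> /andP[-> ->]].
    by [].
  have [qu|qu] := eqVneq q u; last have [qd|qd] := eqVneq q d.
  + apply/card_cover1P; exists (u, d); first by rewrite udM /= qu eqxx.
    move=> l lM; have [//|ne] := eqVneq l (u, d).
    have /and3P[l1 l2 l3] := okl l lM ne.
    by rewrite qu => /orP[]/eqP E; [rewrite E (negPf uus) in l1|rewrite E (negPf uA) in l2].
  + apply/card_cover1P; exists (u, d); first by rewrite udM /= qd eqxx orbT.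
    move=> l lM; have [//|ne] := eqVneq l (u, d).
    have /and3P[l1 l2 l3] := okl l lM ne.
    by rewrite qd => /orP[]/eqP E; [rewrite E (negPf dus) in l1|rewrite E eqxx in l3].
  have := ex q; rewrite in_setD1 qd /=.
  have -> : (q \in us) || (q \in A) by move: qq; rewrite inE (negPf qu).
  move=> /card_cover1P[l [lM lq] lu].
  apply/card_cover1P; exists l; first by move: lM; rewrite !inE => /andP[_ ->].
  move=> l' l'M l'q; apply: lu => //; rewrite !inE l'M andbT.
  apply: contraTneq l'q => -> /=.
  by rewrite !(eq_sym _ q) (negPf qd) (negPf qu).
Qed.

Lemma card_matching (us : seq T) (A : {set T}) :
  uniq us -> {in us, forall q, q \notin A} ->
  #|[set M | matching us A M]| = nmatch us A.
Proof.
elim: us A => [|u us IH] A /=.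
  move=> _ _; have [->|/set0Pn[q qA]] := eqVneq A set0.
    apply/eqP/cards1P; exists set0; apply/setP => M; rewrite !inE.
    apply/andP/eqP => [[/forall_inP ok _]|->].
      by apply/setP => l; rewrite inE; apply/negP => /ok; rewrite in_nil andbF.
    by split; apply/forallP => q; rewrite ?inE.
  apply/eqP; rewrite cards_eq0; apply/eqP/setP => M; rewrite !inE.
  apply/negP => /andP[/forall_inP ok /forallP/(_ q)]; rewrite qA /=.
  by move=> /card_cover1P[l [/ok]]; rewrite in_nil andbF.
move=> /andP[uus uniq_us] dis.
have uA : u \notin A by apply: dis; rewrite mem_head.
have dis' : {in us, forall q, q \notin A}.
  by move=> q qus; apply: dis; rewrite inE qus orbT.
(* Each matching contains exactly one edge at [u], so the inner sum is 1; exchanging the sums sorts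
   the matchings by the partner of [u]. *)
have -> : #|[set M | matching (u :: us) A M]| =
    \sum_(M | matching (u :: us) A M) \sum_(d in A | adj u d) ((u, d) \in M).
  rewrite -sum1_card; apply: eq_big => [M|M]; first by rewrite inE.
  rewrite inE => /andP[/forall_inP ok /forallP/(_ u)]; rewrite mem_head /=.
  case/card_cover1P=> -[p q] [pqM pqu] lu.
  have [/=auq pus qA] := and3P (ok _ pqM).
  have pu : p = u by move: pqu => /orP[/eqP//|/eqP /= qu]; rewrite -qu qA in uA.
  rewrite pu in pqM auq lu.
  rewrite (bigD1 q) /=; last by rewrite qA auq.
  rewrite pqM big1 // => d /andP[_ dq]; case: (boolP (_ \in M)) => // udM.
  by have := lu _ udM; rewrite /= eqxx => /(_ isT)[E]; rewrite E eqxx in dq.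
rewrite exchange_big /=; apply: eq_bigr => d /andP[dA aud].
have dus : d \notin us by apply: contraTN dA => /dis'.
rewrite -IH //; last by move=> q /dis'; rewrite inE negb_and => ->; rewrite orbT.
rewrite -big_mkcondr /= sum1_card -cardsE.
have -> : [set M | matching (u :: us) A M && ((u, d) \in M)] =
  [set (u, d) |: M | M in [set M | matching us (A :\ d) M]].
  apply/setP => M; rewrite inE; apply/andP/imsetP => [[mM udM]|[M']].
    exists (M :\ (u, d)); last by rewrite setD1K.
    by rewrite inE -(matching_rem uus).
  rewrite inE => mM' ->; rewrite setU11; split => //.
  rewrite (@matching_rem _ _ _ d) ?setU11 // setU1K //.
  apply/negP => udM'; case/andP: mM' => /forall_inP/(_ _ udM')/=.
  by rewrite !inE eqxx !andbF.
rewrite card_in_imset // => M1 M2; rewrite !inE => m1 m2 E.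
have n M : matching us (A :\ d) M -> (u, d) \notin M.
  by move=> /andP[/forall_inP ok _]; apply/negP => /ok; rewrite !inE eqxx !andbF.
by rewrite -(setU1K (n _ m1)) E setU1K // n.
Qed.
End Matchings.

(** * Non-intersecting paths *)

Import GRing.Theory.
Local Open Scope ring_scope.

Section RowLists.
Variables (R : comNzRingType) (n : nat).
Implicit Types (l : seq 'rV[R]_n) (u v : 'rV[R]_n).

(** Missing rows count as zero. Lists rather than matrices, so that a row is addressed by the length
    of its prefix while rows come and go. *)
Definition detl l : R := \det (\matrix_(i < n) nth 0 l i).

Lemma detlD l1 u v l2 : (size l1 < n)%N ->
  detl (l1 ++ (u + v) :: l2) = detl (l1 ++ u :: l2) + detl (l1 ++ v :: l2).
Proof.
move=> sn; rewrite /detl; set B := (X in _ = \det X + _); set C := (X in _ + \det X).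
rewrite -[\det B]mul1r -[\det C]mul1r.
apply: (determinant_multilinear (i0 := Ordinal sn)); rewrite /B /C.
- by rewrite !scale1r !rowK /= !nth_cat /= ltnn subnn.
- apply/matrixP => i j; rewrite !mxE !nth_cat /=.
  have: lift (Ordinal sn) i != Ordinal sn by rewrite eq_sym neq_lift.
  rewrite -val_eqE /=; case: ltngtP => // lt _.
  by have [p ->] : exists p, (bump (size l1) i - size l1 = p.+1)%N;
    first by exists (bump (size l1) i - size l1).-1; rewrite prednK // subn_gt0.
- apply/matrixP => i j; rewrite !mxE !nth_cat /=.
  have: lift (Ordinal sn) i != Ordinal sn by rewrite eq_sym neq_lift.
  rewrite -val_eqE /=; case: ltngtP => // lt _.
  by have [p ->] : exists p, (bump (size l1) i - size l1 = p.+1)%N;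
    first by exists (bump (size l1) i - size l1).-1; rewrite prednK // subn_gt0.
Qed.

Lemma detl0 l1 l2 : (size l1 < n)%N -> detl (l1 ++ 0 :: l2) = 0.
Proof.
move=> sn; have := detlD 0 0 l2 sn; rewrite addr0 => /eqP.
by rewrite -subr_eq subrr eq_sym => /eqP.
Qed.

Lemma detl_dup l1 v l2 : (size l1 + 1 < n)%N -> detl (l1 ++ v :: v :: l2) = 0.
Proof.
move=> sn; have sn' : (size l1 < n)%N by lia.
apply: (determinant_alternate (i1 := Ordinal sn') (i2 := Ordinal sn)).
  by rewrite -val_eqE /= addn1 neq_ltn ltnSn.
by move=> j; rewrite !mxE !nth_cat /= ltnn subnn addn1 ltnNge leqnSn /= subSnn.
Qed.

(** The algebraic form of non-intersection: the summand in which a path steps onto the position of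
    the next one has two equal rows. *)
Lemma detl_addnext l1 u v l2 : (size l1 + 1 < n)%N ->
  detl (l1 ++ (u + v) :: v :: l2) = detl (l1 ++ u :: v :: l2).
Proof. by move=> sn; rewrite detlD ?detl_dup ?addr0 //; lia. Qed.

Lemma detl_col0 l (j : 'I_n) : {in l, forall v, v 0 j = 0} -> detl l = 0.
Proof.
move=> l0; rewrite /detl (expand_det_col _ j) big1 // => i _.
rewrite mxE; case: (ltnP i (size l)) => il; last by rewrite nth_default // mxE mul0r.
by rewrite l0 ?mul0r ?mem_nth.
Qed.

Definition unitrow (m : nat) : 'rV[R]_n := \row_j (j == m :> nat)%:R.

Lemma detl_unit : detl [seq unitrow i | i <- iota 0 n] = 1.
Proof.
rewrite /detl -[RHS](det1 R n); congr (\det _); apply/matrixP => i j.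
by rewrite !mxE (nth_map 0%N) ?size_iota // nth_iota // mxE eq_sym.
Qed.
End RowLists.

Lemma iotaSr r : iota 0 r.+1 = iota 0 r ++ [:: r].
Proof. by rewrite -(addn1 r) iotaD. Qed.

Lemma pair_neq (a b c d : nat) : (a != c) || (b != d) -> ((a, b) == (c, d)) = false.
Proof. by rewrite xpair_eqE -negb_and => /negPf. Qed.

(* Strip k consists of the unit triangles between two consecutive lattice
   lines parallel to the southeastern side; (k, r) stands both for its
   up-pointing and for its down-pointing triangle in row r.  The first entry
   of nbrs is across the edge parallel to the northeastern side, the second one
   is in the next strip to the left, the third one is just below. *)
Section Peeling.

Definition nbrs (u : nat * nat) : seq (nat * nat) :=
  [:: (u.1, u.2); (u.1.-1, u.2)] ++ (if u.2 is r.+1 then [:: (u.1, r)] else [::]).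

Variable Dl : seq (nat * nat).

(** The recursion of [nmatch] in strip coordinates. Since [A] lives on an infinite type, the finite
    list [Dl] of candidates serves to test it for emptiness. *)
Fixpoint peel (us : seq (nat * nat)) (A : pred (nat * nat)) : nat :=
  if us is u :: us' then (\sum_(d <- nbrs u | A d) peel us' [pred e | A e & e != d])%N
  else all (predC A) Dl.

Lemma eq_peel us (A A' : pred (nat * nat)) : A =1 A' -> peel us A = peel us A'.
Proof.
elim: us A A' => [|u us IH] A A' E /=.
  by congr (nat_of_bool _); apply: eq_all => d /=; rewrite E.
by apply: eq_big => [//|d _]; apply: IH => e /=; rewrite E.
Qed.

Lemma peel_stuck us (A : pred (nat * nat)) d :
  d \in Dl -> A d -> {in us, forall u, d \notin nbrs u} -> peel us A = 0%N.
Proof.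
move=> dD; elim: us A => [|u us IH] A Ad ne /=.
  by apply/eqP; rewrite eqb0; apply/allPn; exists d; rewrite //= negbK.
rewrite big_seq_cond big1 // => e /andP[eu _]; apply: IH.
  rewrite /= Ad; apply: contraTneq eu => <-.
  by apply: ne; rewrite mem_head.
by move=> u' u'us; apply: ne; rewrite inE u'us orbT.
Qed.

Variables (R : comNzRingType) (n H K : nat) (U D : nat -> nat -> bool).
(** [f k r] stands for the numbers of paths from the down-pointing triangle [(k, r)] to each western
    end, and [M k] for the number of ends [exit k' r] with [k' >= k]. *)
Variables (f : nat -> nat -> 'rV[R]_n) (M : nat -> nat).

(** The missing left neighbour [(k, r)] serves as a virtual last position of a path; there [f] is a
    unit row. *)
Definition exit k r := U k.+1 r && ~~ D k r.

Hypothesis DDl : forall k r, D k r -> (k, r) \in Dl.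
Hypothesis D_H : forall k r, D k r -> (r < H)%N.
Hypothesis U_H : forall k r, U k r -> (r < H)%N.
Hypothesis D0 : forall r, D 0 r = false.
Hypothesis DU : forall k r, (k.+1 < K)%N -> D k r -> U k.+1 r.
Hypothesis f_rec : forall k r, (k.+1 < K)%N -> D k.+1 r -> f k.+1 r = f k r + f k r.+1.
(** A path leaves [(k.+1, r)] through the up-pointing triangle in row [r] or [r.+1]. By this
    hypothesis and the next, [f] vanishes behind a missing one, so [f_rec] may keep both terms. *)
Hypothesis f_here : forall k r, (k.+1 < K)%N -> D k.+1 r -> ~~ U k.+1 r -> f k r = 0.
Hypothesis f_above : forall k r, (k.+1 < K)%N -> D k.+1 r -> ~~ U k.+1 r.+1 -> f k r.+1 = 0.
Hypothesis M0 : M 0 = n.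
Hypothesis M_exit : forall k r, (k.+1 < K)%N -> exit k r ->
  [/\ (M k.+1 < n)%N, f k r = unitrow R n (M k.+1) & M k = (M k.+1).+1].
Hypothesis M_noexit : forall k, (k.+1 < K)%N -> (forall r, ~~ exit k r) -> M k = M k.+1.
Hypothesis exit_U : forall k r p, exit k r -> (p < r)%N -> ~~ U k.+1 p.
Hypothesis exit_DS : forall k r p, exit k r -> (p.+1 < r)%N -> ~~ D k.+1 p.
Hypothesis exit_D : forall k r q, exit k r -> D k q -> (r < q)%N.
Hypothesis exit_f : forall k r q (j : 'I_n), (k.+1 < K)%N -> exit k r -> D k q ->
  j = M k.+1 :> nat -> f k q 0 j = 0.

Definition strip k r := [seq (k, p) | p <- rev (iota 0 r) & U k p].
Fixpoint strips k := if k is k'.+1 then strip k H ++ strips k' else [::].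

Lemma stripS k r : strip k r.+1 = nseq (U k r) (k, r) ++ strip k r.
Proof. by rewrite /strip iotaSr rev_cat /=; case: (U k r). Qed.

Lemma mem_strip k r u : (u \in strip k r) = [&& u.1 == k, u.2 < r & U u.1 u.2]%N.
Proof.
apply/mapP/and3P => [[p]|[/eqP uk ur Uu]]; last first.
  by exists u.2; rewrite ?mem_filter ?mem_rev ?mem_iota -?uk ?Uu //; case: (u).
by rewrite mem_filter mem_rev mem_iota => /andP[Up /andP[_ pr]] -> /=.
Qed.

Lemma mem_strips k u : (u \in strips k) = [&& 0 < u.1, u.1 <= k & U u.1 u.2]%N.
Proof.
elim: k => [|k IH] /=; first by case: (u.1).
rewrite mem_cat IH mem_strip; case: u {IH} => i j /=; have UH := @U_H i j.
by case: (U _ _) UH => [/(_ isT) ->|_]; rewrite ?andbF // !andbT; clear; lia.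
Qed.

Lemma uniq_strips k : uniq (strips k).
Proof.
elim: k => //= k IH; rewrite cat_uniq IH andbT; apply/andP; split.
  rewrite map_inj_uniq; last by move=> p q [].
  by rewrite filter_uniq // rev_uniq iota_uniq.
apply/hasPn => u; rewrite mem_strips mem_strip => /and3P[_ uk _].
by apply/negP => /andP[/eqP e _]; rewrite e ltnn in uk.
Qed.

Lemma nbrs_top k r u : u \in strip k.+1 r ++ strips k -> (k.+1, r) \notin nbrs u.
Proof.
rewrite mem_cat mem_strip mem_strips; case: u => a b /= /orP[/and3P[/eqP -> br _]|].
  rewrite /nbrs !inE !xpair_eqE eqxx /=.
  by case: b br => [|b] br; rewrite ?mem_seq1 ?xpair_eqE ?in_nil /=; lia.
move=> /and3P[_ ak _]; rewrite /nbrs !inE !xpair_eqE /=.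
by case: b => [|b]; rewrite ?mem_seq1 ?xpair_eqE ?in_nil /=; lia.
Qed.

Definition low k r (A : pred (nat * nat)) : seq 'rV[R]_n :=
  [seq f k.+1 p | p <- iota 0 r & A (k.+1, p)].
Definition mid k r (A : pred (nat * nat)) : seq 'rV[R]_n :=
  [seq (if p.+1 == r then f k p else f k.+1 p) | p <- iota 0 r & A (k.+1, p)].
Definition high k r (A : pred (nat * nat)) : seq 'rV[R]_n :=
  [seq f k q | q <- iota r (H - r) & A (k, q) || exit k q].
Definition units m := [seq unitrow R n i | i <- iota 0 m].

Lemma size_units m : size (units m) = m.
Proof. by rewrite size_map size_iota. Qed.

Lemma lowS k r A : low k r.+1 A = low k r A ++ nseq (A (k.+1, r)) (f k.+1 r).
Proof.
by rewrite /low iotaSr filter_cat map_cat /=; case: (A _).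
Qed.

Lemma midS k r A : mid k r.+1 A = low k r A ++ nseq (A (k.+1, r)) (f k r).
Proof.
rewrite /mid /low iotaSr filter_cat map_cat /=; congr (_ ++ _).
  apply/eq_in_map => p; rewrite mem_filter mem_iota => /andP[_ /andP[_]] pr.
  by case: eqP => //; lia.
by case: (A _); rewrite //= eqxx.
Qed.

Lemma highS k r A : (r < H)%N ->
  high k r A = nseq (A (k, r) || exit k r) (f k r) ++ high k r.+1 A.
Proof.
move=> rH; rewrite /high (_ : H - r = (H - r.+1).+1)%N; last by lia.
by rewrite /=; case: (_ || _).
Qed.

Lemma eq_low k r A A' : (forall p, (p < r)%N -> A (k.+1, p) = A' (k.+1, p)) ->
  low k r A = low k r A'.
Proof.
move=> E; rewrite /low; congr map; apply: eq_in_filter => p.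
by rewrite mem_iota add0n => /E.
Qed.

Lemma eq_high k r A A' : (forall p, (r <= p)%N -> A (k, p) = A' (k, p)) ->
  high k r A = high k r A'.
Proof.
move=> E; rewrite /high; congr map; apply: eq_in_filter => p.
by rewrite mem_iota => /andP[/E ->].
Qed.

(** The change of strip. By [exit_D] the exit lies below all down-pointing triangles of its strip,
    so its row comes first in [high] and joins [units] as the next unit row without a permutation,
    hence without a sign. *)
Lemma units_high k (A : pred (nat * nat)) : (k.+1 < K)%N -> (forall q, A (k, q) -> D k q) ->
  units (M k.+1) ++ high k 0 A = units (M k) ++ [seq f k q | q <- iota 0 H & A (k, q)].
Proof.
move=> kK AD; rewrite /high subn0.
case: (boolP [exists q : 'I_H, exit k q]) => [/existsP[q0 ex]|]; last first.
  rewrite negb_exists => /forallP nex.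
  have nex' q : ~~ exit k q.
    by apply/negP => ex; have qH := U_H (proj1 (andP ex)); case/negP: (nex (Ordinal qH)).
  rewrite (M_noexit kK nex'); congr (_ ++ map _ _); apply: eq_filter => q.
  by rewrite (negPf (nex' q)) orbF.
have [_ fe ->] := M_exit kK ex.
rewrite /units iotaSr map_cat /= -fe -catA; congr (_ ++ _).
have EH : iota 0 H = iota 0 q0 ++ nat_of_ord q0 :: iota q0.+1 (H - q0.+1).
  have := iotaD 0 q0 (H - q0); rewrite subnKC; last exact: ltnW.
  move=> ->; congr (_ ++ _); have : (q0 < H)%N by [].
  by move=> h; rewrite add0n (_ : H - q0 = (H - q0.+1).+1)%N //; lia.
have lowE (B : pred nat) : (forall q, (q < q0)%N -> ~~ B q) -> [seq q <- iota 0 q0 | B q] = [::].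
  move=> nB; apply/eqP; rewrite -size_eq0 size_filter -leqn0 leqNgt -has_count.
  by apply/hasPn => q; rewrite mem_iota add0n => /nB.
have nA q : (q <= q0)%N -> ~~ A (k, q).
  by move=> qq; apply/negP => /AD /(exit_D ex); rewrite ltnNge qq.
have nE (q : nat) : q != q0 :> nat -> ~~ exit k q.
  rewrite neq_ltn => /orP[lt|lt]; apply/negP => ex'.
    by have := exit_U ex lt; rewrite (proj1 (andP ex')).
  by have := exit_U ex' lt; rewrite (proj1 (andP ex)).
rewrite EH !filter_cat !map_cat !lowE /=; first last.
- move=> q lt; rewrite negb_or; apply/andP; split; first exact/nA/ltnW.
  by apply: nE; rewrite neq_ltn lt.
- by move=> q lt; rewrite nA // ltnW.
rewrite ex orbT (negPf (nA q0 _)) //=; congr (_ :: map _ _).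
apply: eq_in_filter => q; rewrite mem_iota => /andP[lt _].
by rewrite (negPf (nE q _)) ?orbF // neq_ltn lt orbT.
Qed.

(* Up-pointing triangles are matched one at a time, strip by strip from the
   right and from top to bottom inside a strip.  In the middle of strip k.+1,
   when the ones in rows >= r are done, the paths end at the still unmatched
   down-pointing triangles of strip k.+1 and, in rows >= r, of strip k, or they
   have left the region (units).  A path sitting in row r.-1 of strip k.+1 has
   only one step left to choose from. *)
Definition peel_claim k r := forall A : pred (nat * nat),
  (forall k q, A (k, q) -> D k q) ->
  (forall k' q, (k.+1 < k')%N -> ~~ A (k', q)) ->
  (forall k' q, (k' < k)%N -> A (k', q) = D k' q) ->
  (forall q, (q < r)%N -> A (k, q) = D k q) ->
  (forall q, (r <= q)%N -> ~~ A (k.+1, q)) ->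
  size (units (M k.+1) ++ mid k r A ++ high k r A) = n ->
  (peel (strip k.+1 r ++ strips k) A)%:R = detl (units (M k.+1) ++ mid k r A ++ high k r A).

(** The next triangle to be matched is the up-pointing [(k.+1, r)]. Which of its down-pointing
    neighbours are open tells which paths may pass through it, and each case is a multilinear
    identity in the rows [w], [v] and [w' = w + v]. *)
Lemma peel_claimS k r : (k.+1 < K)%N -> (r < H)%N -> peel_claim k r -> peel_claim k r.+1.
Proof.
move=> kK rH IH A AD A1 A2 A3 A4; rewrite midS !catA => sz.
(* None of the up-pointing triangles still to come borders [(k.+1, r)]. *)
have stuck (B : pred (nat * nat)) : B (k.+1, r) -> (forall k q, B (k, q) -> D k q) ->
    peel (strip k.+1 r ++ strips k) B = 0%N.
  by move=> Br BD; apply: (@peel_stuck _ _ (k.+1, r)) => // [|u /nbrs_top//]; apply/DDl/BD.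
pose below (A' : pred (nat * nat)) := if r is r'.+1 then A' (k.+1, r') else false.
pose pb := below A.
pose v := f k r; pose w := f k r.-1.
pose w' := f k.+1 r.-1.
have lowE : low k r A = low k r.-1 A ++ nseq pb w'.
  by rewrite /pb /below /w'; case: (r) => // r'; rewrite lowS.
have pbD : pb -> r = r.-1.+1 /\ D k.+1 r.-1 by rewrite /pb /below; case: (r) => //= r' /AD.
have wE : pb -> w' = w + v.
  by move=> /pbD[r1 Dr]; rewrite /w' f_rec // -r1.
have midE (A' : pred (nat * nat)) : (forall p, (p < r.-1)%N -> A' (k.+1, p) = A (k.+1, p)) ->
   mid k r A' = low k r.-1 A ++ nseq (below A') w.
  by rewrite /w /below; case: (r) => //= r' E; rewrite midS (eq_low E).
have IH' (A' : pred (nat * nat)) : (forall d, A' d -> A d) -> (forall k' q, (k' < k)%N -> A' (k', q) = A (k', q)) ->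
   (forall q, (q != r)%N -> A' (k, q) = A (k, q)) ->
   (forall p, (p < r.-1)%N -> A' (k.+1, p) = A (k.+1, p)) ->
   ~~ A' (k.+1, r) ->
   let l := units (M k.+1) ++ low k r.-1 A ++
     nseq (below A') w ++
     nseq (A' (k, r) || exit k r) v ++ high k r.+1 A in
   size l = n -> (peel (strip k.+1 r ++ strips k) A')%:R = detl l.
  move=> sub E1 E2 E3 nr l szl.
  have El : units (M k.+1) ++ mid k r A' ++ high k r A' = l.
    rewrite midE // highS // /l -!catA; congr (_ ++ (_ ++ (_ ++ (_ ++ _)))).
    by apply: eq_high => p rp; apply: E2; rewrite neq_ltn rp orbT.
  rewrite -El; apply: IH; last by rewrite El.
  - by move=> k' q /sub /AD.
  - by move=> k' q lt; apply: contra (A1 k' q lt); apply: sub.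
  - by move=> k' q lt; rewrite E1 // A2.
  - by move=> q lt; rewrite E2 ?A3 // ?leqW // neq_ltn lt.
  - by move=> q; rewrite leq_eqVlt => /orP[/eqP <-//|/A4]; apply/contra/sub.
rewrite lowE -!catA in sz *.
have sz1 : (size (units (M k.+1) ++ low k r.-1 A) = M k.+1 + size (low k r.-1 A))%N.
  by rewrite size_cat size_units.
have szE : (M k.+1 + size (low k r.-1 A) + pb + A (k.+1, r) + size (high k r.+1 A) = n)%N.
  by move: sz; rewrite !size_cat !size_nseq size_units !addnA.
have Akr := A3 r (ltnSn r).
(* Without an up-pointing triangle nothing is matched, and the step into row [r] has to vanish in
   the determinant. *)
rewrite stripS -catA; case: (boolP (U k.+1 r)) => Ur /=; last first.
  have nD : ~~ D k r by apply: contra Ur; apply: DU.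
  have nE : ~~ exit k r by rewrite /exit (negPf Ur).
  case: (boolP (A (k.+1, r))) sz szE => Ar sz szE /=.
    rewrite stuck // /v f_here ?AD // catA [X in detl X]catA detl0 //.
    by rewrite !size_cat size_nseq -?size_cat sz1; move: szE; clear; lia.
  rewrite (IH' A) //; rewrite ?Akr ?(negPf nD) ?(negPf nE) //=.
    rewrite -/(below A) -/pb; case: (boolP pb) => // pb1; rewrite /= wE // /v.
    by have [r1 Dr] := pbD pb1; rewrite r1 f_above -?r1 // addr0.
  by rewrite -/(below A) -/pb; rewrite !size_cat !size_nseq size_units /=; move: szE; clear; lia.
have Ex : A (k, r) || exit k r by rewrite Akr /exit Ur; case: (D k r).
have kk1 : k != k.+1 by rewrite neq_ltn ltnSn.
have kr (a b : nat) : ((k, a) == (k.+1, b) :> nat * nat) = false by rewrite pair_neq ?kk1.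
have rk (a b : nat) : ((k.+1, a) == (k, b)) = false by rewrite pair_neq // eq_sym kk1.
have pr1 p : (p < r.-1)%N -> (p != r) && (p != r.-1) by clear; lia.
have k'k (k' a b : nat) : (k' < k)%N -> ((k', a) == (k, b)) = false /\ ((k', a) == (k.+1, b)) = false.
  by move=> lt; split; rewrite pair_neq //; move: lt; clear; lia.
have sum_nbrs (F : nat * nat -> nat) : (\sum_(d <- nbrs (k.+1, r) | A d) F d)%N =
    (A (k.+1, r) * F (k.+1, r) + A (k, r) * F (k, r) + pb * F (k.+1, r.-1))%N.
  rewrite /nbrs /pb /below big_mkcond /= !big_cons; case: (r) => [|r'] /=.
    by rewrite big_nil mul0n !addn0; do 2!case: (A _); rewrite ?mul1n ?mul0n ?addn0.
  by rewrite big_cons big_nil addn0 -addnA; do 3!case: (A _); rewrite ?mul1n ?mul0n ?addn0.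
(* If a path sits at [(k.+1, r)], it must pass through the triangle. A path one row below then
   cannot rise: its summand [v] repeats the next row. *)
rewrite sum_nbrs natrD natrD !natrM; case: (boolP (A (k.+1, r))) sz szE => Ar sz szE /=.
  rewrite mul1r (stuck [pred e | A e & e != (k, r)]) ?mulr0 ?addr0; first last.
  - by move=> k' q /andP[/AD].
  - by rewrite /= Ar eq_sym kr.
  have -> : pb%:R * (peel (strip k.+1 r ++ strips k) [pred e | A e & e != (k.+1, r.-1)])%:R = 0 :> R.
    case: (boolP pb) => [/pbD[r1 _]|]; last by rewrite mul0r.
    rewrite stuck ?mulr0 //=; first by rewrite Ar pair_neq //; move: r1; clear; lia.
    by move=> k' q /andP[/AD].
  have bl : below [pred e | A e & e != (k.+1, r)] = pb.
    rewrite /pb /below; case: (r) => //= r'.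
    by rewrite pair_neq ?andbT //; clear; lia.
  rewrite addr0 IH' /=; first last.
  - rewrite -/below bl kr andbT Ex !size_cat !size_nseq size_units /=; move: szE; clear; lia.
  - by rewrite eqxx andbF.
  - by move=> p /pr1/andP[pr pr']; rewrite pair_neq ?andbT // ?pr ?pr' orbT.
  - by move=> q qr; rewrite kr andbT.
  - by move=> k' q kk; rewrite (k'k _ _ _ kk).2 andbT.
  - by move=> d /andP[].
  rewrite -/below bl kr andbT Ex /=; case: (boolP pb) sz szE => //= pb1 sz szE.
  rewrite (wE pb1) !catA detl_addnext // sz1; move: szE; clear; lia.
(* Otherwise a path one row below either rises through the triangle ([v]) or stays ([w]); if it
   stays, the triangle is matched with its left neighbour. *)
case: (boolP pb) sz szE => pb1 sz szE /=.
  have [r1 Dr] := pbD pb1.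
  have -> : (peel (strip k.+1 r ++ strips k) [pred e | A e & e != (k.+1, r.-1)])%:R =
     detl (units (M k.+1) ++ low k r.-1 A ++ v :: high k r.+1 A).
    have bl : below [pred e | A e & e != (k.+1, r.-1)] = false.
      by rewrite /below; case: (r) r1 => //= r' _; rewrite eqxx andbF.
    rewrite IH' /=; first last.
    - rewrite -/below bl kr andbT Ex !size_cat !size_nseq size_units /=; move: szE; clear; lia.
    - by rewrite negb_and Ar.
    - by move=> p /pr1/andP[pr pr']; rewrite pair_neq ?andbT // ?pr ?pr' orbT.
    - by move=> q qr; rewrite kr andbT.
    - by move=> k' q kk; rewrite (k'k _ _ _ kk).2 andbT.
    - by move=> d /andP[].
    by rewrite -/below bl kr andbT Ex.
  rewrite mul0r add0r mul1r (wE pb1) !catA detlD ?sz1; last by move: szE; clear; lia.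
  (* At an exit there is no left neighbour, so staying is impossible; accordingly [w] is zero. *)
  congr (_ + _); case: (boolP (A (k, r))) => Akr1; last first.
    have ex : exit k r by move: Ex; rewrite (negPf Akr1).
    have Ur1 : ~~ U k.+1 r.-1 by apply: (exit_U ex); move: r1; clear; lia.
    by rewrite mul0r /w f_here // detl0 // sz1; move: szE; clear; lia.
  have nex : exit k r = false by rewrite /exit -Akr Akr1 andbF.
  have bl : below [pred e | A e & e != (k, r)] = pb.
    by rewrite /pb /below; case: (r) => //= r'; rewrite rk andbT.
  rewrite mul1r -!catA IH' /=; first last.
  - rewrite -/below bl nex eqxx andbF pb1 !size_cat !size_nseq size_units /=; move: szE; clear; lia.
  - by rewrite negb_and Ar.
  - by move=> p pr; rewrite rk andbT.
  - by move=> q qr; rewrite pair_neq ?andbT // qr orbT.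
  - by move=> k' q kk; rewrite (k'k _ _ _ kk).1 andbT.
  - by move=> d /andP[].
  by rewrite -/below bl nex eqxx andbF pb1.
rewrite !mul0r add0r addr0; case: (boolP (A (k, r))) => Akr1.
  have nex : exit k r = false by rewrite /exit -Akr Akr1 andbF.
  have bl : below [pred e | A e & e != (k, r)] = pb.
    by rewrite /pb /below; case: (r) => //= r'; rewrite rk andbT.
  rewrite mul1r IH' /=; first last.
  - rewrite -/below bl nex eqxx andbF (negPf pb1) !size_cat !size_nseq size_units /=; move: szE; clear; lia.
  - by rewrite negb_and Ar.
  - by move=> p pr; rewrite rk andbT.
  - by move=> q qr; rewrite pair_neq ?andbT // qr orbT.
  - by move=> k' q kk; rewrite (k'k _ _ _ kk).1 andbT.
  - by move=> d /andP[].
  by rewrite -/below bl nex eqxx andbF (negPf pb1).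
(* No path reaches this exit: the triangle cannot be matched, and the column of this western end
   vanishes in all rows. *)
have ex : exit k r by move: Ex; rewrite (negPf Akr1).
have [Mn _ _] := M_exit kK ex.
rewrite mul0r (@detl_col0 _ _ _ (Ordinal Mn)) // => u.
rewrite !mem_cat => /or3P[/mapP[i]|/mapP[p]|/mapP[q]].
- rewrite mem_iota add0n => /andP[_ iM] ->; rewrite mxE /=.
  by rewrite (gtn_eqF iM).
- rewrite mem_filter mem_iota add0n => /andP[Ap /andP[_ pr]] _.
  have pr' : (p.+1 < r)%N.
    by move: pr; clear; lia.
  by have := exit_DS ex pr'; rewrite AD.
- rewrite mem_filter mem_iota => /andP[/orP[/AD Dq|ex'] /andP[rq _]] ->.
    exact: exit_f ex Dq _.
  by have := exit_U ex' rq; rewrite Ur.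
Qed.

Lemma mid_high k (A : pred (nat * nat)) : (k.+1 < K)%N ->
  (forall q, A (k.+1, q) -> D k.+1 q) ->
  [seq f k.+1 q | q <- iota 0 H & A (k.+1, q)] = mid k H A ++ high k H A.
Proof.
move=> kK AD; rewrite /high subnn cats0 /mid; apply/eq_in_map => q.
rewrite mem_filter => /andP[/AD Dq _]; case: eqP => // qH.
rewrite f_rec // f_above ?addr0 // qH.
by apply/negP => /U_H; rewrite ltnn.
Qed.

Lemma peel_det k r : (k.+1 < K)%N -> (r <= H)%N -> peel_claim k r.
Proof.
elim: k r => [|k IHk] r kK; elim: r => [|r IHr] rH; try by apply: peel_claimS => //; apply/IHr/ltnW.
- move=> A AD A1 _ _ A4 _ /=.
  have AF d : A d = false.
    apply/negP; case: d => [[|[|k']] q] Ad; first by have := AD _ _ Ad; rewrite D0.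
      by have := A4 q isT; rewrite Ad.
    by have := A1 k'.+2 q isT; rewrite Ad.
  have -> : all (predC A) Dl by apply/allP => d _ /=; rewrite AF.
  rewrite (units_high kK); last by move=> q; rewrite AF.
  rewrite (eq_filter (a2 := pred0)) ?filter_pred0 /=; last by move=> q; rewrite AF.
  by rewrite cats0 M0 /units detl_unit.
- move=> A AD A1 A2 _ A4.
  rewrite [mid _ 0 _]/= [[::] ++ _]/= (units_high kK); last by move=> q; apply: AD.
  rewrite (mid_high (ltnW kK) (AD k.+1)).
  apply: IHk => //; first exact: ltnW.
  - move=> k' q; rewrite leq_eqVlt => /orP[/eqP <-|]; [exact: A4|exact: A1].
  - by move=> k' q lt; apply: A2; apply: ltnW.
  - by move=> q _; apply: A2.
  - by move=> q; apply: contraL => /AD /D_H; rewrite ltnNge.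
Qed.

(** In the last strip every down-pointing triangle starts a path, as no strip to its right can cover
    it. *)
Lemma peel_strips k : (k.+1 < K)%N -> (forall k' q, (k.+1 < k')%N -> ~~ D k' q) ->
  let l := units (M k.+1) ++ [seq f k.+1 q | q <- iota 0 H & D k.+1 q] in
  size l = n -> (peel (strips k.+1) (fun d => D d.1 d.2))%:R = detl l.
Proof.
move=> kK Dk l; pose A d := D d.1 d.2; rewrite /l (@mid_high _ A) // => sz.
apply: (@peel_det _ H) => // q; apply: contraL => /D_H; rewrite ltnNge //.
Qed.
End Peeling.

Local Close Scope ring_scope.

(** * From lozenge tilings of the region to the peeling count *)

Lemma seq_preim (T : Type) (T' : eqType) (h : T -> T') (P : pred T) (l : seq T') :
  {in l, forall e, exists2 q, h q = e & P q} ->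
  exists2 us : seq T, map h us = l & all P us.
Proof.
elim: l => [|e l IH] El; first by exists [::].
have [q qe Pq] := El e (mem_head e l).
case: IH => [e' e'l|us ul Pus]; first by apply: El; rewrite inE e'l orbT.
by exists (q :: us); rewrite /= ?qe ?ul ?Pq.
Qed.

Lemma nmatch_peel (T : finType) (adj : rel T) (g h : T -> nat * nat) (Dl : seq (nat * nat))
    (us : seq T) (A0 A : {set T}) :
  {in A0 &, injective g} -> A \subset A0 -> {in A0, forall d, g d \in Dl} ->
  {in us, forall u, uniq (nbrs (h u))} ->
  {in us & A0, forall u d, adj u d = (g d \in nbrs (h u))} ->
  nmatch adj us A = peel Dl (map h us) (fun e => [exists d in A, g d == e]).
Proof.
move=> ginj + gD; elim: us A => [|u us IH] A AA0 nu adjE /=.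
  congr (nat_of_bool _); apply/eqP/allP => [-> d _ /=|al].
    by apply/negP => /exists_inP[d']; rewrite inE.
  apply/setP => d; rewrite inE; apply/negP => dA.
  have /al /negP[] : g d \in Dl by apply/gD/(subsetP AA0).
  by apply/exists_inP; exists d.
rewrite -[RHS]big_filter.
have pe : perm_eq [seq d <- nbrs (h u) | [exists d0 in A, g d0 == d]]
                  [seq g d | d <- enum A & adj u d].
  apply: uniq_perm; first by rewrite filter_uniq // nu // mem_head.
    rewrite map_inj_in_uniq; first exact/filter_uniq/enum_uniq.
    move=> d d'; rewrite (mem_filter _ d (enum A)) (mem_filter _ d' (enum A)) !mem_enum => /andP[_ /(subsetP AA0) dA] /andP[_ /(subsetP AA0) d'A].
    exact: ginj.
  move=> e; rewrite mem_filter; apply/andP/mapP => [[/exists_inP[d dA /eqP <-] ne]|[d]].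
    exists d => //; rewrite mem_filter mem_enum dA andbT adjE ?mem_head //.
    exact: (subsetP AA0).
  rewrite mem_filter mem_enum => /andP[ad dA] ->; split.
    by apply/exists_inP; exists d.
  by rewrite -adjE ?mem_head //; apply: (subsetP AA0).
rewrite (perm_big _ pe) big_map big_filter /= big_enum_cond /=.
apply: eq_bigr => d /andP[dA _]; rewrite IH; first last.
- by move=> u' d' u'us; apply: adjE; rewrite inE u'us orbT.
- by move=> u' u'us; apply: nu; rewrite inE u'us orbT.
- by apply: subset_trans AA0; apply: subD1set.
apply: eq_peel => e /=; apply/exists_inP/andP => [[d']|[/exists_inP[d' d'A /eqP ge] ed]].
  rewrite inE => /andP[dd' d'A] /eqP <-; split; first by apply/exists_inP; exists d'.
  by apply: contraNneq dd' => /ginj -> //; rewrite ?inE //; apply: (subsetP AA0).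
exists d'; last exact/eqP.
by rewrite !inE d'A andbT; apply: contraNneq ed => <-; rewrite ge.
Qed.

(* The triangle of Defs at row r and position t belongs to strip k, where
   t + 2 B = 2 k + r if it points down and t + 1 + 2 B = 2 k + r if it points
   up. *)
Section Region.
Variables x y z a : nat.
Let B := (y + z + a)%N.
Let K := (x + 2 * (y + z) + 4 * a)%N.

(** The conditions are, in order, the western, southern-to-northern, southeastern and northeastern
    bounds. The western up-pointing triangle in strip [k] has rank [k] from the top, so the removed
    ones are those of strips [y + 1] to [y + a]. *)
Definition upR k r := [&& 2 * B < 2 * k + r, r < 2 * B, k < K, k + 2 * r < x + 4 * B &
   ~~ ((2 * k + r == 2 * B + 1) && (y < k <= y + a))].
Definition downR k r := [&& 2 * B <= 2 * k + r, r < 2 * B, k < K & k + 2 * r + 2 <= x + 4 * B].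

Lemma Rregion_up k r t : t + 1 + 2 * B = 2 * k + r -> r < 2 * B ->
  Rregion x y z a (r, t) = upR k r.
Proof.
rewrite /Rregion /pentagon /west_up_rank /upR /is_up /= /K /B => E rB.
have o : odd (r + t) by lia.
rewrite o /= rB (_ : r < _ = true); last by lia.
have -> : (t == 0) = (2 * k + r == 2 * (y + z + a) + 1) by lia.
have -> : (2 * (y + z + a) < 2 * k + r) by lia.
case: eqP => e; last by case: ifP; lia.
have -> : (2 * (y + z + a) + 1 - r) %/ 2 = k by lia.
by case: ifP; lia.
Qed.

Lemma Rregion_down k r t : t + 2 * B = 2 * k + r -> r < 2 * B ->
  Rregion x y z a (r, t) = downR k r.
Proof.
rewrite /Rregion /pentagon /downR /is_up /= /K /B => E rB.
have o : odd (r + t) = false by lia.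
rewrite o /= andbF andbT (_ : r < _ = true) //=; last by lia.
by case: ifP; lia.
Qed.

Let T := box (Rhb x y z a) (Rnb x y z a).
Let hup (q : T) := ((q.2 + 1 + 2 * B - q.1)./2, nat_of_ord q.1).
Let gdown (q : T) := ((q.2 + 2 * B - q.1)./2, nat_of_ord q.1).
Let ups := [pred q : T | Rregion x y z a (pt q) && is_up (pt q)].
Let downs := [set q : T | Rregion x y z a (pt q) & ~~ is_up (pt q)].
Let Dl := [seq (k, r) | k <- iota 0 K, r <- iota 0 (2 * B)].

Lemma hupE (q : T) : is_up (pt q) -> q.2 + 1 + 2 * B = 2 * (hup q).1 + (hup q).2.
Proof.
have qB : q.1 < 2 * B by exact: ltn_ord.
rewrite /is_up /hup /pt /=; move: (nat_of_ord q.1) (nat_of_ord q.2) qB => i j; clear; lia.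
Qed.

Lemma gdownE (q : T) : ~~ is_up (pt q) -> q.2 + 2 * B = 2 * (gdown q).1 + (gdown q).2.
Proof.
have qB : q.1 < 2 * B by exact: ltn_ord.
rewrite /is_up /gdown /pt /=; move: (nat_of_ord q.1) (nat_of_ord q.2) qB => i j; clear; lia.
Qed.

Lemma M_R_peel k : K = k.+2 ->
  M_R x y z a = peel Dl (strips (2 * B) upR k.+1) (fun d => downR d.1 d.2).
Proof.
move=> Kk.
have qB (q : T) : q.1 < 2 * B by exact: ltn_ord.
have upsE (q : T) : is_up (pt q) -> ups q = upR (hup q).1 (hup q).2.
  move=> uq; rewrite /ups /= uq andbT (Rregion_up (hupE uq)) //; exact: qB.
have downsE (q : T) : ~~ is_up (pt q) -> (q \in downs) = downR (gdown q).1 (gdown q).2.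
  by move=> uq; rewrite inE uq andbT (Rregion_down (gdownE uq)) //; apply: qB.
have hinj : {in ups &, injective hup}.
  move=> [q1 q2] [p1 p2] /andP[_ uq] /andP[_ up] e.
  have := hupE uq; rewrite e -(hupE up) => /addIn/addIn/val_inj /= ->.
  by case: e => _ /val_inj ->.
have ginj : {in downs &, injective gdown}.
  move=> [q1 q2] [p1 p2]; rewrite !inE => /andP[_ uq] /andP[_ up] e.
  have := gdownE uq; rewrite e -(gdownE up) => /addIn/val_inj /= ->.
  by case: e => _ /val_inj ->.
have upRB k' r : upR k' r -> r < 2 * B by case/and5P.
have strip_in e : (e \in strips (2 * B) upR k.+1) = upR e.1 e.2.
  rewrite (mem_strips upRB) andbA andbC; case: (boolP (upR _ _)) => //= /and5P[].
  lia.
have [us usE /allP usP] : exists2 us : seq T, map hup us = strips (2 * B) upR k.+1 & all ups us.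
  apply: seq_preim => -[k' r]; rewrite strip_in /= => U'.
  have := U' => /and5P[u1 u2 u3 u4 _].
  have tB : 2 * k' + r - (2 * B + 1) < Rnb x y z a by rewrite /Rnb -/B; lia.
  pose q : T := (Ordinal u2, Ordinal tB).
  have uq : is_up (pt q) by rewrite /is_up /pt /=; lia.
  have hq : hup q = (k', r) by rewrite /hup /=; congr (_, _); lia.
  have uu : ups q by rewrite upsE // hq.
  by exists q.
have us_uniq : uniq us.
  by apply: (@map_uniq _ _ hup); rewrite usE (uniq_strips upRB).
have usM (q : T) : (q \in us) = ups q.
  apply/idP/idP => [/usP//|uq].
  have : hup q \in strips (2 * B) upR k.+1.
    by rewrite strip_in -upsE //; case/andP: uq.
  by rewrite -usE => /mapP[q' q'us /hinj ->] //; apply: usP.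
rewrite /M_R /ntilings.
have -> : [set M : {set T * T} | is_tiling (Rregion x y z a) M] =
   [set M | matching (fun u d : T => lozenge (pt u) (pt d)) us downs M].
  apply/setP => M; rewrite !inE; congr (_ && _).
    apply: eq_forallb_in => -[u d] _ /=; rewrite usM !inE /=.
    by case L: (lozenge _ _) => //=; case/and3P: L => -> -> _; rewrite !andbT.
  apply: eq_forallb => q; rewrite usM !inE /= -andb_orr orbN andbT.
  by [].
rewrite card_matching //; last first.
  by move=> q; rewrite usM !inE /= => /andP[_ ->]; rewrite andbF.
rewrite (@nmatch_peel _ _ gdown hup Dl us downs) //; first last.
- move=> [u1 u2] [d1 d2]; rewrite usM !inE => /andP[_ uu] /andP[_ ud].
  have := hupE uu; have := gdownE ud; have := qB (u1, u2); have := qB (d1, d2).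
  move: uu ud; rewrite /lozenge /is_up /nbrs /hup /gdown /pt /=.
  move: (nat_of_ord u1) (nat_of_ord u2) (nat_of_ord d1) (nat_of_ord d2).
  move=> {u1 u2 d1 d2} r t r' t' -> -> /=.
  by case: r => [|r]; rewrite ?in_nil ?mem_seq1 !xpair_eqE; clear; lia.
- move=> u; rewrite usM => /andP[_ uu]; have := hupE uu; have := qB u; rewrite /hup /=.
  move: (nat_of_ord u.1) (nat_of_ord u.2) => r t rB E.
  by rewrite /nbrs; case: r rB E => [|r] rB E /=;
    rewrite ?inE ?in_nil !xpair_eqE; move: rB E; clear; lia.
- move=> d dd; rewrite /Dl; apply/allpairsP; exists (gdown d) => /=.
  have ud : ~~ is_up (pt d) by move: dd; rewrite inE => /andP[].
  move: dd; rewrite downsE // => /and4P[_ d2 d3 _].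
  by split; rewrite ?mem_iota ?add0n ?d2 ?d3 //; case: (gdown d).
rewrite usE; apply: eq_peel => -[k' r] /=.
apply/exists_inP/idP => [[d dd /eqP ge]|dR].
  have ud : ~~ is_up (pt d) by move: dd; rewrite inE => /andP[].
  by move: dd; rewrite downsE // ge.
have := dR => /and4P[u1 u2 u3 u4].
have tB : 2 * k' + r - (2 * B) < Rnb x y z a by rewrite /Rnb -/B; lia.
pose q : T := (Ordinal u2, Ordinal tB).
have uq : ~~ is_up (pt q) by rewrite /is_up /pt /=; lia.
have hq : gdown q = (k', r) by rewrite /gdown /=; congr (_, _); lia.
by exists q; rewrite ?hq // downsE // hq.
Qed.
End Region.

(* Paths with m steps from height r to height e, each step rising by 0 or 1. *)
Definition steps (m r e : nat) : nat := if r <= e then 'C(m, e - r) else 0.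

Lemma stepsS m r e : steps m.+1 r e = steps m r e + steps m r.+1 e.
Proof.
rewrite /steps; case: ltngtP => [re|//|->]; last by rewrite subnn !bin0.
by rewrite (_ : e - r = (e - r.+1).+1) ?binS //; lia.
Qed.

Lemma steps_gt m r e : e < r -> steps m r e = 0.
Proof. by rewrite /steps ltnNge; case: leqP. Qed.

Lemma steps_far m r e : m + r < e -> steps m r e = 0.
Proof. by move=> h; rewrite /steps; case: leqP => // _; rewrite bin_small //; lia. Qed.

(** Flat and rising steps are exchanged. This makes the two terms of [pathF] cancel on the
    reflecting line. *)
Lemma steps_sym m r e e' : e + e' = m + 2 * r -> steps m r e = steps m r e'.
Proof.
move=> E; have [re|re] := leqP r e; last first.
  by rewrite steps_gt // steps_far //; lia.
have [re'|re'] := leqP r e'; last first.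
  by rewrite (steps_gt _ re') steps_far //; lia.
rewrite /steps re re' (_ : e' - r = m - (e - r)) ?bin_sub //; lia.
Qed.

Lemma steps_diag m r : steps m r r = 1.
Proof. by rewrite /steps leqnn subnn bin0. Qed.

Local Opaque steps.

(** * The path matrix and the reflection principle *)

Section PathMatrix.
Variables x y z a : nat.
Let n := (y + z)%N.
Let B := (y + z + a)%N.
Let X := x + 3 * B.
Let K := (x + 2 * (y + z) + 4 * a)%N.

(* Reflection principle: the number of paths from the down-pointing triangle
   (k, r) to the j-th western up-pointing triangle, counted from the bottom. *)
Definition pathF k r j : rat := if B <= k + j then
  ((steps (k + j - B) r (2 * j - 1))%:R - (steps (k + j - B) r (X - j))%:R)%R else 0%R.

(** Counted from the bottom, the removed western triangles are those with numbers [z + 1] to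
    [z + a]. *)
Definition jcol i := if i < z then i + 1 else i + a + 1.

Lemma jcol_bounds i : i < n -> [/\ 0 < jcol i, jcol i <= B & (jcol i <= z) || (z + a < jcol i)].
Proof. by rewrite /n /B /jcol => ni; split; case: ifP; lia. Qed.

Definition pathrow k r : 'rV[rat]_n := (\row_i pathF k r (jcol i))%R.

Lemma pathF_rec k r j : 0 < j <= B -> downR x y z a k.+1 r ->
  pathF k.+1 r j = (pathF k r j + pathF k r.+1 j)%R.
Proof.
move=> /andP[j0 jB] /and4P[d1 d2 d3 d4]; rewrite /pathF.
rewrite -/B in d1 d2 d4.
have [h|h] := leqP B (k + j).
  rewrite (_ : B <= k.+1 + j); last by lia.
  have -> : k.+1 + j - B = (k + j - B).+1 by move: h; clear; lia.
  by rewrite !stepsS !natrD opprD addrACA.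
rewrite addr0; case: leqP => // h'.
rewrite (_ : _ - B = 0); last by lia.
rewrite (@steps_gt _ _ (2 * j - 1)) ?(@steps_far _ _ (X - j)) ?subrr // /X; lia.
Qed.

(** The line [k + 2 r = x + 4 B - 1] runs just beyond the northeastern side. The [j]-th end is the
    virtual position [(B - j, 2 j - 1)], and its mirror image in this line is [(B - j, X - j)]; this
    is where [X] comes from. *)
Lemma pathF_top k r j : 0 < j <= B -> k + 2 * r + 1 = x + 4 * B -> pathF k r j = 0%R.
Proof.
move=> jB E; rewrite /pathF; case: ifP => // h.
rewrite (@steps_sym _ _ (2 * j - 1) (X - j)) ?subrr // /X; lia.
Qed.

(** All ends lie on the line [2 k + r = 2 B - 1], and [2 k + r] decreases strictly along a path, so
    no path joins two points of this line. *)
Lemma pathF_wall k r j : 0 < j <= B -> k + j != B -> 2 * k + r = 2 * B - 1 -> pathF k r j = 0%R.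
Proof.
move=> jB ne E; rewrite /pathF; case: ifP => // h.
by rewrite !steps_far ?subrr // /X; lia.
Qed.

Lemma pathF_wall0 k r j : 0 < j <= B -> 2 * k + r + 2 = 2 * B -> pathF k r j = 0%R.
Proof.
move=> jB E; rewrite /pathF; case: ifP => // h.
by rewrite !steps_far ?subrr // /X; lia.
Qed.

(** The [j]-th end has [k = B - j]; this counts the remaining columns [j <= B - k]. *)
Definition nexits k := minn z (B - k) + minn y (B - k - (z + a)).

Lemma pathF_exit k j : 0 < j <= B -> k < B ->
  pathF k (2 * B - 2 * k - 1) j = (if j + k == B then 1%R else 0%R).
Proof.
move=> jB kB; case: eqP => [E|/eqP ne]; last first.
  by apply: pathF_wall => //; [move: ne; clear; lia|lia].
rewrite /pathF (_ : B <= k + j); last by lia.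
rewrite (_ : k + j - B = 0) ; last by lia.
rewrite (@steps_far _ _ (X - j)) /X; last by lia.
by rewrite (_ : 2 * j - 1 = 2 * B - 2 * k - 1) ?steps_diag ?subr0 //; lia.
Qed.

Lemma jcol_nexits k (i : nat) : i < n -> k < B ->
  (B - k <= z) || (z + a < B - k) -> (jcol i + k == B) = (i == nexits k.+1).
Proof.
rewrite /jcol /nexits /n /B => ni kB h; case: ifP; lia.
Qed.

Lemma pathrow0 k r : (forall j : 'I_n, pathF k r (jcol j) = 0%R) -> pathrow k r = 0%R.
Proof. by move=> h; apply/rowP => j; rewrite !mxE h. Qed.

Lemma upR_dent k r : k < B -> 2 * k + r = 2 * B - 1 -> upR x y z a k.+1 r ->
  (B - k <= z) || (z + a < B - k).
Proof.
move=> kB E /and5P[_ _ _ _]; rewrite -/B negb_and negb_and => /or3P[]; rewrite /B; lia.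
Qed.

Lemma exitE k r : exit (upR x y z a) (downR x y z a) k r ->
  [/\ k < B, r = 2 * B - 2 * k - 1 & (B - k <= z) || (z + a < B - k)].
Proof.
case/andP=> u nd; have [u1 u2 u3 u4 _] := and5P u; rewrite -/B in u1 u2 u4.
have kB : k < B.
  rewrite ltnNge; apply: contra nd => Bk; rewrite /downR -/B; lia.
have E : 2 * k + r = 2 * B - 1.
  move: nd; rewrite /downR -/B; lia.
split=> //; [lia|exact: upR_dent E u].
Qed.

Lemma pathrow_up0 k r : (forall j : 'I_n, pathF k r (jcol j) = 0%R) \/
   (k < B /\ 2 * k + r = 2 * B - 1 /\ y < k.+1 <= y + a) -> pathrow k r = 0%R.
Proof.
case=> [h|[kB [E dent]]]; apply: pathrow0 => // j.
have [j0 jB jz] := jcol_bounds (ltn_ord j).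
by apply: pathF_wall => //; rewrite ?j0 // /B; move: dent jz; rewrite /B; clear; lia.
Qed.

Lemma M_R_det : 0 < B ->
  ((M_R x y z a)%:R = \det (\matrix_(i < n, j < n) pathF K.-1 i (jcol j)) :> rat)%R.
Proof.
move=> B0; have [k Kk] : exists k, K = k.+2.
  by exists (K - 2); move: B0; rewrite /K /B; clear; lia.
have jb (j : 'I_n) : 0 < jcol j <= B by have [-> -> _] := jcol_bounds (ltn_ord j).
have nex : nexits k.+1 = 0.
  by move: Kk B0; rewrite /nexits /K /B; clear; lia.
have mids : [seq q <- iota 0 (2 * B) | downR x y z a k.+1 q] = iota 0 n.
  rewrite (_ : 2 * B = n + (2 * B - n)); last by rewrite /B /n; clear; lia.
  rewrite iotaD filter_cat [X in _ ++ X](eq_in_filter (a2 := pred0)); last first.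
    by move=> q; rewrite mem_iota /downR => h; apply/negP => /and4P[_ _ _];
      move: h Kk; rewrite /K /B /n; clear; lia.
  rewrite filter_pred0 cats0 (eq_in_filter (a2 := predT)) ?filter_predT //.
  move=> q; rewrite mem_iota /downR => h; apply/and4P; split;
    move: h Kk B0; rewrite /K /B /n; clear; lia.
rewrite (M_R_peel Kk).
rewrite (@peel_strips _ _ n (2 * B) K (upR x y z a) (downR x y z a) pathrow nexits).
- rewrite nex mids /= /detl; congr (\det _)%R; apply/matrixP => i j.
  by rewrite !mxE (nth_map 0) ?size_iota // nth_iota // mxE Kk.
- move=> k' r /and4P[_ r1 r2 _]; apply/allpairsP; exists (k', r).
  by split; rewrite ?mem_iota.
- by move=> k' r /and4P[].
- by move=> k' r /and5P[].
- by move=> r; apply/negP => /and4P[]; rewrite -/B; clear; lia.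
- move=> k' r k'K; rewrite /downR /upR; move: k'K; rewrite -/B -/K => k'K.
  by move=> /and4P[d1 d2 d3 d4]; apply/and5P; split; move: d1 d2 d3 d4 k'K; rewrite /B /K; clear; lia.
- by move=> k' r k'K d; apply/rowP => j; rewrite !mxE pathF_rec.
- move=> k' r k'K d u; have [d1 d2 d3 d4] := and4P d; rewrite -/B in d1 d2 d4.
  apply: pathrow_up0; have [E|ne] := eqVneq (2 * k' + r + 2) (2 * B).
    by left=> j; apply: pathF_wall0.
  right; move: u; rewrite /upR -/B -/K d2 d3 /=.
  by move: d1 d4 ne; rewrite /B; clear; lia.
- move=> k' r k'K d u; have [d1 d2 d3 d4] := and4P d; rewrite -/B in d1 d2 d4.
  apply: pathrow_up0; have [E|ne] := eqVneq (k' + 2 * r.+1 + 1) (x + 4 * B).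
    by left=> j; apply: pathF_top.
  have [E|ne'] := eqVneq r.+1 (2 * B).
    left=> j; have := jb j; rewrite /pathF; case: ifP => // h jB.
    rewrite steps_gt ?steps_far ?subrr //; move: jB d4 E h; rewrite /X /B; clear; lia.
  right; move: u; rewrite /upR -/B -/K d3 /=.
  by move: d1 d2 d4 ne ne'; rewrite /B; clear; lia.
- by rewrite /nexits /n /B; clear; lia.
- move=> k' r k'K /exitE[kB -> h].
  have E : (nexits k'.+1).+1 = nexits k' by move: h kB; rewrite /nexits /B; clear; lia.
  split=> //; first by move: kB h; rewrite /nexits /n /B; clear; lia.
  apply/rowP => j; rewrite !mxE pathF_exit // jcol_nexits //.
  by case: eqP.
- move=> k' k'K nE; have [kB|kB] := ltnP k' B; last first.
    by move: kB; rewrite /nexits; clear; lia.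
  have nz : ~~ ((B - k' <= z) || (z + a < B - k')).
    apply: contra (nE (2 * B - 2 * k' - 1)) => h; rewrite /exit /upR /downR -/B -/K.
    apply/andP; split; last by apply/negP => /and4P[]; move: kB; clear; lia.
    apply/and5P; split; move: k'K kB h; rewrite /B; clear; lia.
  by move: nz; rewrite /nexits /B; clear; lia.
- move=> k' r p /exitE[kB -> h] lt; apply/negP => /and5P[]; move: lt; rewrite -/B; clear; lia.
- move=> k' r p /exitE[kB -> h] lt; apply/negP => /and4P[]; move: lt; rewrite -/B; clear; lia.
- by move=> k' r q /exitE[kB -> h] /and4P[]; rewrite -/B; clear -kB; lia.
- move=> k' r q j k'K /exitE[kB rE h] /and4P[d1 d2 d3 d4] jE; rewrite mxE.
  rewrite -/B in d1 d2 d4.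
  have E : jcol j + k' == B by rewrite jcol_nexits // jE.
  have jB := jb j; rewrite /pathF; case: ifP => // _.
  rewrite steps_gt ?steps_far ?subrr //; move: E jB d1 d4; rewrite /X; clear; lia.
- by move: Kk => ->.
- by move=> k' q lt; apply/negP => /and4P[_ _]; rewrite -/K Kk; move: lt; clear; lia.
- by rewrite nex mids size_map size_iota.
Qed.
End PathMatrix.

Local Transparent steps.

(** * Ballot numbers *)

Import Num.Theory.

(* p = m - i; the value is 0 for negative p, where m - i would be truncated. *)
Definition ballot (m i q : nat) : rat :=
  if i <= m then ((q%:R - (m - i)%:R) * (m - i + q - 1)`!%:R / ((m - i)`!%:R * q`!%:R))%R
  else 0%R.

Lemma fact_neq0 n : (n`!%:R != 0 :> rat)%R.
Proof. by rewrite pnatr_eq0 -lt0n fact_gt0. Qed.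

Lemma bin_ratE m p : p <= m -> ('C(m, p)%:R = m`!%:R / (p`!%:R * (m - p)`!%:R) :> rat)%R.
Proof.
move=> pm; rewrite -(bin_fact pm) !natrM mulfK //.
by rewrite mulf_neq0 ?fact_neq0.
Qed.

Lemma ballotE (p q : nat) : (0 < q)%N ->
  ('C(p + q - 1, p)%:R - 'C(p + q - 1, q)%:R =
   (q%:R - p%:R) * (p + q - 1)`!%:R / (p`!%:R * q`!%:R) :> rat)%R.
Proof.
case: q => // q _; rewrite addnS subn1 /=.
rewrite (bin_ratE (leq_addr q p)) addKn factS natrM.
have q0 := fact_neq0 q; have p0 := fact_neq0 p.
have q1 : (q.+1%:R != 0 :> rat)%R by rewrite pnatr_eq0.
case: p p0 => [|p] p0.
  rewrite add0n bin_small // fact0 -natr1; rewrite -natr1 in q1.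
  by field; rewrite q0 addrC q1.
rewrite (bin_ratE (m := p.+1 + q)) ?addSn ?ltnS ?leq_addl //.
have -> : (p + q).+1 - q.+1 = p by lia.
rewrite !factS !natrM -!natr1; rewrite -!natr1 in q1.
have p1 : (p%:R + 1 != 0 :> rat)%R by rewrite natr1 pnatr_eq0.
have pp := fact_neq0 p.
by field; rewrite q0 q1 pp p1.
Qed.

Section RowOps.
Variables x y z a : nat.
Let n := (y + z)%N.
Let B := (y + z + a)%N.
Let X := x + 3 * B.
Let K := (x + 2 * (y + z) + 4 * a)%N.
Let pF := pathF x y z a.

(* Row i of the matrix counts the paths that start in row i of strip kap i. *)
Definition detlines (kap : nat -> nat) : rat :=
  (\det (\matrix_(i < n, j < n) pF (kap i) i (jcol z a j)))%R.

Lemma eq_detlines (kap kap' : nat -> nat) : (forall i, i < n -> kap i = kap' i) -> detlines kap = detlines kap'.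
Proof.
by move=> E; congr (\det _)%R; apply/matrixP => i j; rewrite !mxE E.
Qed.

Lemma pathF_recB k r j : B <= k + j -> (pF k.+1 r j = pF k r j + pF k r.+1 j)%R.
Proof.
move=> h; rewrite /pF /pathF -/B h (_ : B <= k.+1 + j); last by rewrite addSn leqW.
have -> : k.+1 + j - B = (k + j - B).+1 by move: h; clear; lia.
by rewrite !stepsS !natrD opprD addrACA.
Qed.

(** The path recurrence splits row [q] in two. The second summand starts at [(k, q.+1)]: it either
    repeats the next row or lies on the reflecting line, where [pathF] is zero. *)
Lemma detlines_lower (kap kap' : nat -> nat) q k : B <= k -> q < n ->
  (forall i : nat, i != q -> kap' i = kap i) -> kap q = k.+1 -> kap' q = k ->
  (q.+1 < n) && (kap q.+1 == k) || (k + 2 * q.+1 + 1 == x + 4 * B) ->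
  detlines kap = detlines kap'.
Proof.
move=> Bk qn E Eq Eq' next.
pose C := (\matrix_(i < n, j < n) pF (if i == q :> nat then k else kap i)
  (if i == q :> nat then q.+1 else i) (jcol z a j))%R.
have -> : detlines kap = (1 * detlines kap' + 1 * \det C)%R.
  apply: (determinant_multilinear (i0 := Ordinal qn)).
  - apply/rowP => j; rewrite !mxE !mul1r /= eqxx Eq Eq' pathF_recB //.
    exact: leq_trans Bk (leq_addr _ _).
  - apply/matrixP => i j; rewrite !mxE E //.
    by have := neq_lift (Ordinal qn) i; rewrite eq_sym -val_eqE.
  - apply/matrixP => i j; rewrite !mxE.
    by have := neq_lift (Ordinal qn) i; rewrite eq_sym -val_eqE /= => /negPf ->.
rewrite !mul1r [X in (_ + X)%R](_ : _ = 0%R) ?addr0 //.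
case/orP: next => [/andP[q1n /eqP kq]|/eqP top].
  apply: (determinant_alternate (i1 := Ordinal qn) (i2 := Ordinal q1n)).
    by rewrite -val_eqE /= neq_ltn ltnSn.
  by move=> j; rewrite !mxE /= eqxx (gtn_eqF (ltnSn q)) kq.
rewrite /C (expand_det_row _ (Ordinal qn)) big1 // => j _; rewrite !mxE /= eqxx.
have [j0 jB _] := jcol_bounds x a (ltn_ord j).
by rewrite /pF pathF_top ?mul0r // ?j0 -/B.
Qed.

Local Opaque detlines.

(** Rows are lowered in the order [q], [q - 1], .., 0, so that each of them below [q] finds the next
    row already in strip [k]. *)
Lemma detlines_lower_block (kap : nat -> nat) q k : B <= k -> q < n -> (forall i : nat, i <= q -> kap i = k.+1) ->
  (q.+1 < n) && (kap q.+1 == k) || (k + 2 * q.+1 + 1 == x + 4 * B) ->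
  detlines kap = detlines (fun i => if i <= q then k else kap i).
Proof.
move=> Bk qn Eq next.
have : forall m, m <= q.+1 ->
    detlines kap = detlines (fun i => if (i <= q) && (q < i + m) then k else kap i).
  elim=> [_|m IH mq].
    by apply: eq_detlines => i _; case: ifP => //; clear; lia.
  rewrite (IH (ltnW mq)); apply: (@detlines_lower _ _ (q - m) k Bk).
  - by move: qn mq; clear; lia.
  - move=> i ne; have -> : (i <= q) && (q < i + m.+1) = (i <= q) && (q < i + m).
      by move: ne mq; clear; lia.
    by [].
  - by rewrite ifF ?Eq //; move: mq; clear; lia.
  - by rewrite ifT //; move: mq; clear; lia.
  - have [m0|m0] := posnP m.
      rewrite m0 subn0 ifF; last by clear; lia.
      exact: next.
    rewrite (_ : (q - m).+1 < n); last by move: qn m0 mq; clear; lia.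
    by rewrite ifT ?eqxx //; move: mq m0; clear; lia.
move=> /(_ q.+1 (leqnn _)) ->; apply: eq_detlines => i _.
by rewrite (_ : q < i + q.+1) ?andbT //; clear; lia.
Qed.

(** The strip given to row [i] is the one where [k + 2 i = x + 4 B - 2], one step before the
    reflecting line. *)
Lemma detlines_spread : 0 < n ->
  detlines (fun i => K.-1 + 2 * (n - i) - 1) = detlines (fun=> K.-1).
Proof.
move=> n0; pose kT i := K.-1 + 2 * (n - i) - 1.
(* Rows 0 to [p] stand together in strip [kT p] and move to [kT p.+1 = kT p - 2]: the first lowering
   is allowed by the reflecting line, the second by row [p.+1]. *)
have : forall p, p < n -> detlines kT = detlines (fun i => if i <= p then kT p else kT i).
  elim=> [_|p IH pn].
    by apply: eq_detlines => i _; rewrite leqn0; case: eqP => // ->.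
  have kp : (kT p).-2 = kT p.+1 by move: pn; rewrite /kT; clear; lia.
  have kp2 : 1 < kT p by move: pn; rewrite /kT; clear; lia.
  have kB : B <= (kT p).-2 by move: pn; rewrite /kT /K /B /n; clear; lia.
  rewrite IH ?(ltnW pn) // (@detlines_lower_block _ p (kT p).-1) ?(ltnW pn) //; first last.
  - rewrite [X in _ || X](_ : _ = true) ?orbT //.
    by move: pn; rewrite /kT /K /B /n; clear; lia.
  - by move=> i ->; move: kp2; clear; lia.
  - by move: kB; clear; lia.
  rewrite (@detlines_lower_block _ p (kT p).-2) ?(ltnW pn) //; first last.
  - by rewrite ltnn pn kp eqxx.
  - by move=> i ip; rewrite ip; move: kp2; clear; lia.
  apply: eq_detlines => i _; rewrite kp; case: (ltngtP i p) => h.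
  - by rewrite (leqW (ltnW h)).
  - by case: ifP => // ip; congr kT; move: h ip; clear; lia.
  - by rewrite h leqnSn.
move=> /(_ n.-1); rewrite ltn_predL => /(_ n0) ->.
have -> : kT n.-1 = K.-1.+1 by move: n0; rewrite /kT; clear; lia.
rewrite (@detlines_lower_block _ n.-1 K.-1) ?ltn_predL //.
- apply: eq_detlines => i ni; rewrite ifT //; move: ni; clear; lia.
- by move: n0; rewrite /K /B /n; clear; lia.
- by move=> i ->.
- by rewrite [X in _ || X](_ : _ = true) ?orbT //; move: n0; rewrite /K /B /n; clear; lia.
Qed.

Local Transparent detlines.

(** With [p = 2 j - 1 - i] and [q = X - j - i], a path from there has [p + q - 1] steps; [p] of them
    rise on the way to the [j]-th end, [q] on the way to its mirror image. *)
Lemma pathF_ballot i j : i < n -> 0 < j <= B ->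
  pF (K.-1 + 2 * (n - i) - 1) i j = ballot (2 * j - 1) i (X - j - i).
Proof.
move=> ni jB; rewrite /pF /pathF -/B -/X ifT; last first.
  by move: ni jB; rewrite /K /B /n; clear; lia.
have -> : K.-1 + 2 * (n - i) - 1 + j - B = X + j - 2 - 2 * i.
  by move: ni jB; rewrite /X /K /B /n; clear; lia.
rewrite /ballot; case: leqP => h; last first.
  by rewrite steps_gt // steps_far ?subrr //; move: h jB ni; rewrite /X /B /n; clear; lia.
have h' : i <= X - j by move: ni jB; rewrite /X /B /n; clear; lia.
rewrite /steps h h' -ballotE; last by move: ni jB; rewrite /X /B /n; clear; lia.
have -> // : X + j - 2 - 2 * i = 2 * j - 1 - i + (X - j - i) - 1.
by move: ni jB h h'; rewrite /X /B /n; clear; lia.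
Qed.

Lemma M_R_ballot : ((M_R x y z a)%:R =
  \det (\matrix_(i < n, j < n) ballot (2 * jcol z a j - 1) i (X - jcol z a j - i)) :> rat)%R.
Proof.
have jb (j : 'I_n) : 0 < jcol z a j <= B by have [-> -> _] := jcol_bounds x a (ltn_ord j).
(* For [y = z = 0] the determinant is empty; if also [a = 0], the region is empty and has only the
   empty tiling. *)
have [n0|n0] := posnP n; last first.
  have B0 : 0 < B by move: n0; rewrite /B /n; clear; lia.
  rewrite M_R_det // -/n -[LHS](detlines_spread n0).
  by congr (\det _)%R; apply/matrixP => i j; rewrite !mxE pathF_ballot.
have det0n (A : 'M[rat]_n) : (\det A = 1)%R by move: A; rewrite n0 => A; rewrite det_mx00.
rewrite det0n; have [B0|B0] := posnP B; last by rewrite M_R_det.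
have noq (q : box (Rhb x y z a) (Rnb x y z a)) : false.
  by have := ltn_ord q.1; rewrite [X in _ < X](_ : _ = 2 * B) // B0.
rewrite /M_R /ntilings (_ : [set _ | _] = [set set0]) ?cards1 //.
apply/setP => S; rewrite !inE; apply/andP/eqP => [_|->].
  by apply/setP => l; have := noq l.1.
by split; apply/forallP => l; [have := noq l.1|have := noq l].
Qed.
End RowOps.

Local Open Scope ring_scope.

(** * Determinantal recurrences *)

Section ListDet.
Variables (R : comNzRingType) (n : nat).
Implicit Types (l : seq 'rV[R]_n) (u v : 'rV[R]_n).

Lemma detl_swap l1 u v l2 : (size l1 + 1 < n)%N ->
  detl (l1 ++ u :: v :: l2) = - detl (l1 ++ v :: u :: l2).
Proof.
move=> sn; have sn' : (size l1 < n)%N by move: sn; clear; lia.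
have snr (w : 'rV[R]_n) : (size (rcons l1 w) < n)%N by rewrite size_rcons -addn1.
have := detl_dup (u + v) l2 sn; rewrite detlD // -(cat_rcons u) -(cat_rcons v) !detlD // !cat_rcons.
by rewrite !detl_dup // add0r addr0 => /eqP; rewrite addr_eq0 => /eqP.
Qed.

Lemma detl_move l1 u l2 : (size l1 + size l2 < n)%N ->
  detl (l1 ++ u :: l2) = (-1) ^+ size l2 * detl (l1 ++ l2 ++ [:: u]).
Proof.
elim: l2 l1 => [|v l2 IH] l1 /= sn; first by rewrite expr0 mul1r.
rewrite detl_swap; last by move: sn; clear; lia.
rewrite -cat_rcons IH ?size_rcons; last by move: sn; clear; lia.
by rewrite cat_rcons exprS mulN1r mulNr.
Qed.

Lemma detl_linear l1 l2 : (size l1 < n)%N ->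
  exists C : 'cV[R]_n, forall u, detl (l1 ++ u :: l2) = (u *m C) 0 0.
Proof.
move=> sn; pose i0 := Ordinal sn.
exists (\col_j cofactor (\matrix_(i < n) nth 0 (l1 ++ 0 :: l2) i) i0 j) => u.
rewrite /detl (expand_det_row _ i0) mxE; apply: eq_bigr => j _.
rewrite !mxE nth_cat ltnn subnn; congr (_ * (_ * \det _)).
apply/matrixP => i k; rewrite !mxE !nth_cat.
have: lift i0 i != i0 by rewrite eq_sym neq_lift.
rewrite -val_eqE /= neq_ltn; case: ltnP => //= h1 h2.
by rewrite -(subnSK h2).
Qed.
End ListDet.

(* W is an alternating bilinear form that vanishes when an argument is in the
   span of K1 and K2, so it only depends on the coordinates along p and q. *)
Lemma detl_pluecker (F : fieldType) (n : nat) (K1 K2 : seq 'rV[F]_n) (p q r s : 'rV[F]_n) :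
  (size K1 + size K2 + 2 = n)%N ->
  let W u v := detl (K1 ++ u :: K2 ++ [:: v]) in W p q != 0 ->
  W p q * W r s - W p r * W q s + W p s * W q r = 0.
Proof.
move=> sz W Wpq.
have W0 u : W u u = 0.
  rewrite /W detl_move ?size_cat /=; last by move: sz; clear; lia.
  rewrite -catA /= catA detl_dup ?mulr0 // size_cat.
  by rewrite -[X in (_ < X)%N]sz ltn_add2l.
have szl u v : size (K1 ++ u :: K2 ++ [:: v]) = n.
  by rewrite size_cat /= size_cat /=; move: sz; clear; lia.
have K1n : (size K1 < n)%N by move: sz; clear; lia.
have WDl u u' v : W (u + u') v = W u v + W u' v by rewrite /W detlD.
have WDr u v v' : W u (v + v') = W u v + W u v'.
  by rewrite /W -!cat_cons !catA detlD // !size_cat /=; move: sz; clear; lia.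
have WC u v : W v u = - W u v.
  have := W0 (u + v); rewrite WDl !WDr !W0 add0r addr0 addrC => /eqP.
  by rewrite addr_eq0 => /eqP.
pose A := \matrix_(i < n) nth 0 (K1 ++ p :: K2 ++ [:: q]) i.
have Au : A \in unitmx by rewrite unitmxE unitfE.
have [al [be Wr]] : exists al be, forall v, W r v = al * W p v + be * W q v.
  have K2n : (size K1 + size K2 + 1 < n)%N by move: sz; clear; lia.
  pose c := r *m invmx A; exists (c 0 (Ordinal K1n)), (c 0 (Ordinal K2n)) => v.
  have [C WE] := detl_linear (K2 ++ [:: v]) K1n.
  have WE' u : W u v = (u *m C) 0 0 by apply: WE.
  rewrite [LHS]WE' -[r](mulmxKV Au) -/c -mulmxA mxE.
  have ne : Ordinal K2n != Ordinal K1n by rewrite -val_eqE /=; apply/eqP; clear; lia.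
  rewrite (bigD1 (Ordinal K1n)) //= (bigD1 (Ordinal K2n)) //= big1 ?addr0 => [|i /andP[ni1 ni2]].
    have row_mul i : (A *m C) i 0 = (nth 0 (K1 ++ p :: K2 ++ [:: q]) i *m C) 0 0.
      by rewrite !mxE; apply: eq_bigr => j _; rewrite !mxE.
    rewrite !row_mul /= !WE' !nth_cat ltnn subnn /=.
    rewrite ifF; last by clear; lia.
    by rewrite (_ : _ - size K1 = (size K2).+1)%N /= ?nth_cat ?ltnn ?subnn //; clear; lia.
  have -> : (A *m C) i 0 = (nth 0 (K1 ++ p :: K2 ++ [:: q]) i *m C) 0 0.
    by rewrite !mxE; apply: eq_bigr => j _; rewrite !mxE.
  rewrite -WE' [X in _ * X](_ : _ = 0) ?mulr0 // /W.
  apply: (determinant_alternate (i1 := i) (i2 := Ordinal K1n)) => // j.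
  rewrite !mxE; congr (fun_of_matrix _ 0 j); rewrite !nth_cat /= ltnn subnn /=.
  move: ni1 ni2; rewrite -!val_eqE /= => ni1 ni2; case: ltnP => // i1.
  have [m mE] : exists m, (i - size K1 = m.+1)%N.
    by exists (i - size K1).-1; move: ni1 i1; clear; lia.
  have aux k1 k2 m' i' : (i' - k1 = m'.+1 -> i' != k1 + k2 + 1 -> i' < k1 + k2 + 2 -> m' < k2)%N.
    by clear; lia.
  have mK2 : (m < size K2)%N by apply: (aux (size K1) _ _ i) => //; rewrite sz.
  by rewrite mE /= !nth_cat mK2.
rewrite Wr (WC r p) Wr (WC r q) Wr !W0 (WC p q); ring.
Qed.

Section FunDet.
Variable R : comNzRingType.
Implicit Types (g : nat -> R) (gs : seq (nat -> R)).

(** Rows given by functions on [nat] can be reused at every order [N]. Inserting [dlt m] strikes out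
    index [m], so minors become determinants of the larger order. *)
Definition detf N gs : R := detl [seq \row_(i < N) g i | g <- gs].
Definition dlt (m i : nat) : R := (i == m)%:R.
Definition shiftf g (i : nat) : R := g i.+1.

Lemma detf_minor N gs1 gs2 (m : 'I_N.+1) : (size gs1 <= N)%N ->
  detf N.+1 (gs1 ++ dlt m :: gs2) =
  (-1) ^+ (size gs1 + m) * detf N [seq (fun i => g (bump m i)) | g <- gs1 ++ gs2].
Proof.
rewrite -ltnS => sN; pose i0 := Ordinal sN.
rewrite /detf /detl (expand_det_row _ i0) (bigD1 m) //= big1 ?addr0 => [|j jm].
  rewrite !mxE /= map_cat nth_cat size_map ltnn subnn /= mxE /dlt eqxx mul1r.
  rewrite /cofactor /=; congr (_ * \det _); apply/matrixP => i j.
  rewrite !mxE !map_cat !nth_cat !size_map /=.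
  have: lift i0 i != i0 by rewrite eq_sym neq_lift.
  rewrite -val_eqE /= /bump; case: (leqP (size gs1) i) => h /=; last first.
    by rewrite add0n h => _; rewrite -map_comp !(nth_map (dlt 0)) //= !mxE.
  rewrite add1n ltnNge leqW //= => _; rewrite subSn //=.
  have [hh|hh] := ltnP (i - size gs1) (size gs2).
    by rewrite -map_comp !(nth_map (dlt 0)) //= !mxE.
  by rewrite !nth_default ?size_map // !mxE.
rewrite !mxE /= map_cat nth_cat size_map ltnn subnn /= mxE /dlt.
by rewrite (_ : (j == m :> nat) = false) ?mul0r //; apply/negbTE.
Qed.

Lemma eq_detf N gs gs' : size gs = size gs' ->
  (forall k i, (k < size gs)%N -> (i < N)%N -> nth (dlt 0) gs k i = nth (dlt 0) gs' k i) ->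
  detf N gs = detf N gs'.
Proof.
move=> sz E; rewrite /detf; congr detl; apply: (@eq_from_nth _ 0); rewrite !size_map // => k ks.
rewrite !(nth_map (dlt 0)) -?sz //; apply/rowP => i; rewrite !mxE; exact: E.
Qed.

Lemma detf_last N gs1 gs2 : (size gs1 <= N)%N ->
  detf N.+1 (gs1 ++ dlt N :: gs2) = (-1) ^+ (size gs1 + N) * detf N (gs1 ++ gs2).
Proof.
move=> sN; rewrite (detf_minor gs2 ord_max) //; congr (_ * _).
apply: eq_detf; rewrite size_map // => k i ks iN; rewrite (nth_map (dlt 0)) //=.
by rewrite /bump leqNgt iN.
Qed.

Lemma detf_first N gs1 gs2 : (size gs1 <= N)%N ->
  detf N.+1 (gs1 ++ dlt 0 :: gs2) = (-1) ^+ size gs1 * detf N [seq shiftf g | g <- gs1 ++ gs2].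
Proof. by move=> sN; rewrite (detf_minor gs2 ord0) // addn0. Qed.

Lemma detf_move N gs1 g gs2 : (size gs1 + size gs2 < N)%N ->
  detf N (gs1 ++ g :: gs2) = (-1) ^+ size gs2 * detf N (gs1 ++ gs2 ++ [:: g]).
Proof.
by move=> sN; rewrite /detf !map_cat /= detl_move ?size_map // map_cat.
Qed.
End FunDet.

Lemma detf_pluecker (F : fieldType) (N : nat) (K1 K2 : seq (nat -> F)) (p q r s : nat -> F) :
  (size K1 + size K2 + 2 = N)%N ->
  let W u v := detf N (K1 ++ u :: K2 ++ [:: v]) in W p q != 0 ->
  W p q * W r s - W p r * W q s + W p s * W q r = 0.
Proof.
move=> sz W; rewrite /W /detf !map_cat /= !map_cat => W0.
by apply: detl_pluecker; rewrite ?size_map.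
Qed.

Section Gap.
Variable X : nat.

Definition gcol (j i : nat) : rat := ballot (2 * j - 1) i (X - j - i).

(* The columns z.+1, .., b are skipped. *)
Definition gapdet (z b y : nat) : rat :=
  detf (z + y) [seq gcol j | j <- iota 1 z ++ iota b.+1 y].

(** The relation of order [z + y + 2] for the columns [z + 1], [b + 1], [b + y + 2] and the last
    unit vector; columns 1 to [z] and [b + 2] to [b + y + 1] are common to all terms. *)
Lemma gapdet_rec z b y : gapdet z.+1 b y.+1 != 0 ->
  gapdet z.+1 b y.+1 * gapdet z b.+1 y.+1 - gapdet z.+1 b.+1 y.+1 * gapdet z b y.+1
  + gapdet z b y.+2 * gapdet z.+1 b.+1 y = 0.
Proof.
pose K1 := [seq gcol j | j <- iota 1 z]; pose K2 := [seq gcol j | j <- iota b.+2 y].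
pose p := gcol z.+1; pose q := gcol b.+1; pose r := gcol (b + y).+2.
have s1 : size K1 = z by rewrite size_map size_iota.
have s2 : size K2 = y by rewrite size_map size_iota.
pose W u v := detf (z + y).+2 (K1 ++ u :: K2 ++ [:: v]).
have iz : [seq gcol j | j <- iota 1 z.+1] = K1 ++ [:: p].
  by rewrite -(addn1 z) iotaD map_cat /= add1n.
have iy1 : [seq gcol j | j <- iota b.+1 y.+1] = q :: K2 by [].
have iy2 : [seq gcol j | j <- iota b.+2 y.+1] = K2 ++ [:: r].
  by rewrite -(addn1 y) iotaD map_cat /= !addSn.
have iy3 : [seq gcol j | j <- iota b.+1 y.+2] = q :: K2 ++ [:: r].
  by rewrite -iy2.
have sgn2 m : (-1) ^+ (m.+1 + m).+1 = 1 :> rat.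
  by rewrite -addnS addnn -mul2n exprM sqrrN !expr1n.
have E1 : gapdet z.+1 b y.+1 = (-1) ^+ y * W p q.
  rewrite /gapdet map_cat iz iy1 -catA /= addSn addnS -cat_rcons detf_move ?s2 ?cat_rcons //.
  by rewrite size_rcons s1; clear; lia.
have E2 : gapdet z b.+1 y.+1 = (-1) ^+ y * W r (dlt _ (z + y).+1).
  have -> : W r (dlt _ (z + y).+1) = (-1) ^+ (2 * (z + y).+1) * detf (z + y).+1 ((K1 ++ r :: K2) ++ [::]).
    rewrite /W -cat_cons catA (detf_last _ _) ?size_cat /= ?s1 ?s2 ?addnS //.
    by rewrite mul2n -addnn [in RHS]addnS.
  rewrite cats0 detf_move ?s1 ?s2 ?ltnSn // -iy2 -map_cat.
  rewrite exprM sqrrN !expr1n mul1r mulrA -expr2 -exprM mulnC exprM sqrrN expr1n mul1r.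
  by rewrite /gapdet addnS map_cat.
have E3 : gapdet z.+1 b.+1 y.+1 = W p r.
  by rewrite /gapdet map_cat iz iy2 -catA addSn addnS.
have E4 : gapdet z b y.+1 = W q (dlt _ (z + y).+1).
  rewrite /W -cat_cons catA detf_last ?size_cat /= ?s1 ?s2 ?addnS //.
  by rewrite sgn2 mul1r cats0 /gapdet map_cat iy1 addnS.
have E5 : gapdet z b y.+2 = W q r.
  by rewrite /gapdet map_cat iy3 !addnS.
have E6 : gapdet z.+1 b.+1 y = W p (dlt _ (z + y).+1).
  rewrite /W -cat_cons catA detf_last ?size_cat /= ?s1 ?s2 ?addnS //.
  by rewrite sgn2 mul1r cats0 /gapdet map_cat iz -catA.
rewrite E1 E2 E3 E4 E5 E6 => Wpq.
have sgn : (-1) ^+ y * (-1) ^+ y = 1 :> rat by rewrite -expr2 -exprM mulnC exprM sqrrN !expr1n.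
have Wpq' : W p q != 0 by move: Wpq; rewrite mulf_eq0 negb_or => /andP[].
have sz : (size K1 + size K2 + 2 = (z + y).+2)%N by rewrite s1 s2 addn2.
have := detf_pluecker r (dlt _ (z + y).+1) sz Wpq'; rewrite -/(W _ _) => P.
by rewrite mulrACA sgn mul1r [X in _ + X]mulrC; exact: P.
Qed.
End Gap.

(** Consecutive columns only need odd [s], but striking out index 0 lowers [s] by one, so
    condensation requires both parities. Dropping the first column raises [s] by two. *)
Definition ccol (s e k i : nat) : rat := ballot (s + 2 * k) i (e - i - k).
Definition consdet (s e y : nat) : rat := detf y [seq ccol s e k | k <- iota 0 y].

Lemma ballotSS m i q : ballot m.+1 i.+1 q = ballot m i q.
Proof. by rewrite /ballot subSS ltnS. Qed.

Lemma iota1 m : iota 1 m = [seq k.+1 | k <- iota 0 m].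
Proof. exact: (iotaDl 1 0 m). Qed.

Lemma shift_ccol s e k : shiftf (ccol s.+1 e k) =1 ccol s e.-1 k.
Proof.
move=> i; rewrite /shiftf /ccol addSn ballotSS; congr (ballot _ _ (_ - _)%N).
by clear; lia.
Qed.

Lemma ccolS s e k : ccol s e k.+1 =1 ccol s.+2 e.-1 k.
Proof. by move=> i; rewrite /ccol; congr (ballot _ _ _); clear; lia. Qed.

Lemma eq_detf_map N (T : Type) (h h' : T -> nat -> rat) (l : seq T) :
  (forall t, h t =1 h' t) -> detf N [seq h t | t <- l] = detf N [seq h' t | t <- l].
Proof.
move=> E; rewrite /detf -!map_comp; congr detl; apply: eq_map => t /=.
by apply/rowP => i; rewrite !mxE E.
Qed.

(** Condensation is the three-term relation for [dlt 0], [dlt y.+1] and the first and last columns;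
    the leading determinant is the central minor. *)
Lemma consdet_rec s e y : consdet s.+2 e.-2 y != 0 ->
  consdet s.+1 e y.+2 * consdet s.+2 e.-2 y =
  consdet s.+1 e y.+1 * consdet s.+2 e.-2 y.+1 - consdet s.+3 e.-1 y.+1 * consdet s e.-1 y.+1.
Proof.
pose K := [seq ccol s.+1 e k | k <- iota 1 y].
pose p := ccol s.+1 e 0; pose q := ccol s.+1 e y.+1.
have sK : size K = y by rewrite size_map size_iota.
pose W u v := detf y.+2 ([::] ++ u :: K ++ [:: v]).
have Kq : K ++ [:: q] = [seq ccol s.+1 e k.+1 | k <- iota 0 y.+1].
  by rewrite /K -(addn1 y) iotaD map_cat /= add0n iota1 -map_comp.
have KE : K = [seq ccol s.+1 e k.+1 | k <- iota 0 y] by rewrite /K iota1 -map_comp.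
have pK : p :: K = [seq ccol s.+1 e k | k <- iota 0 y.+1] by [].
have sh k : shiftf (ccol s.+1 e k.+1) =1 ccol s.+2 e.-2 k.
  by move=> i; rewrite shift_ccol ccolS.
have mv (gs1 : seq (nat -> rat)) g : size gs1 = y -> detf y.+1 (gs1 ++ [:: g]) = (-1) ^+ y * detf y.+1 (g :: gs1).
  move=> s1; rewrite (detf_move (gs1 := [::])) ?s1 //= mulrA.
  by rewrite -expr2 -exprM mulnC exprM sqrrN !expr1n mul1r.
have sgn : (-1) ^+ y * (-1) ^+ y = 1 :> rat by rewrite -expr2 -exprM mulnC exprM sqrrN !expr1n.
have Wpq : W p q = consdet s.+1 e y.+2.
  rewrite /W /= Kq /consdet (_ : iota 0 y.+2 = 0%N :: iota 1 y.+1) //.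
  by rewrite (iota1 y.+1) map_cons -map_comp.
have sKs : size [seq shiftf g | g <- K] = y by rewrite size_map.
have W0l : W (dlt _ 0) (dlt _ y.+1) = consdet s.+2 e.-2 y.
  rewrite /W detf_first //= expr0 mul1r map_cat /=.
  have -> : detf y.+1 ([seq shiftf g | g <- K] ++ [:: shiftf (dlt rat y.+1)]) =
            detf y.+1 ([seq shiftf g | g <- K] ++ [:: dlt rat y]).
    by rewrite /detf !map_cat.
  rewrite (detf_last [::]) sKs // cats0 exprD sgn mul1r KE -map_comp.
  exact: eq_detf_map.
have W0p : W (dlt _ 0) p = (-1) ^+ y * consdet s e.-1 y.+1.
  rewrite /W detf_first //= expr0 mul1r map_cat /= (mv _ _ sKs).
  rewrite -map_cons pK -map_comp; congr (_ * _); apply: eq_detf_map => k; exact: shift_ccol.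
have Wlq : W (dlt _ y.+1) q = - (-1) ^+ y * consdet s.+3 e.-1 y.+1.
  rewrite /W detf_last //= add0n exprS mulN1r Kq; congr (_ * _).
  by apply: eq_detf_map => k; apply: ccolS.
have W0q : W (dlt _ 0) q = consdet s.+2 e.-2 y.+1.
  rewrite /W detf_first //= expr0 mul1r Kq -map_comp; apply: eq_detf_map => k; exact: sh.
have Wlp : W (dlt _ y.+1) p = - consdet s.+1 e y.+1.
  by rewrite /W detf_last //= add0n exprS mulN1r mv // pK mulrA mulNr sgn mulN1r.
move=> nz0; have nz : W (dlt rat 0) (dlt rat y.+1) != 0 by rewrite W0l.
have sz : (0 + size K + 2 = y.+2)%N by rewrite sK addn2.
have := detf_pluecker (K1 := [::]) p q sz nz; rewrite -/(W _ _) => P.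
have {}P : W (dlt rat 0) (dlt rat y.+1) * W p q - W (dlt rat 0) p * W (dlt rat y.+1) q +
   W (dlt rat 0) q * W (dlt rat y.+1) p = 0 by exact: P.
move: P; rewrite W0l Wpq W0p Wlq W0q Wlp => P.
have : consdet s.+2 e.-2 y * consdet s.+1 e y.+2 =
   - ((-1) ^+ y * (-1) ^+ y) * (consdet s e.-1 y.+1 * consdet s.+3 e.-1 y.+1) +
   consdet s.+2 e.-2 y.+1 * consdet s.+1 e y.+1.
  by apply/eqP; rewrite -subr_eq0 -P; apply/eqP; ring.
rewrite sgn => E; rewrite mulrC E; ring.
Qed.

Lemma consdet0 s e : consdet s e 0 = 1.
Proof. by rewrite /consdet /detf /detl det_mx00. Qed.

Lemma consdet1 s e : consdet s e 1 = ballot s 0 e.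
Proof. by rewrite /consdet /detf /detl det_mx11 !mxE /= ?mxE /ccol muln0 addn0 !subn0. Qed.

(** For [s = 0] the first column is [dlt 0]. This case is out of reach of [consdet_rec], which
    lowers [s]. *)
Lemma consdet_s0 e y : (0 < e)%N -> consdet 0 e y.+1 = consdet 1 e.-2 y.
Proof.
move=> e0; rewrite /consdet /=.
have -> : detf y.+1 (ccol 0 e 0 :: [seq ccol 0 e k | k <- iota 1 y]) =
          detf y.+1 ([::] ++ dlt rat 0 :: [seq ccol 0 e k | k <- iota 1 y]).
  apply: eq_detf => // -[|k] i _ _ //=; rewrite /ccol /dlt muln0 addn0 subn0 /ballot leqn0.
  case: eqP => // ->; rewrite !subn0 add0n subr0 fact0 mul1r.
  case: e e0 => // e _; rewrite subn1 /= factS natrM divff //.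
  by rewrite mulf_neq0 ?fact_neq0 // pnatr_eq0.
rewrite detf_first //= expr0 mul1r iota1 -!map_comp; apply: eq_detf_map => k i /=.
rewrite /shiftf /ccol (_ : 0 + 2 * k.+1 = (1 + 2 * k).+1)%N; last by clear; lia.
by rewrite ballotSS; congr (ballot _ _ _); clear; lia.
Qed.

Lemma gapdet_cons X b y : gapdet X 0 b y = consdet (2 * b + 1) (X - 1 - b) y.
Proof.
rewrite /gapdet /consdet /= add0n -(addn0 b.+1) iotaDl -map_comp; apply: eq_detf_map => k i /=.
by rewrite /gcol /ccol; congr (ballot _ _ _); clear; lia.
Qed.

Lemma gapdet_full X z b : gapdet X z b 0 = gapdet X 0 0 z.
Proof. by rewrite /gapdet /= cats0 addn0. Qed.

Lemma gapdet_nogap X z y : gapdet X z z y = gapdet X 0 0 (z + y).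
Proof. by rewrite /gapdet /= add0n iotaD add1n. Qed.

Lemma M_R_gapdet x y z a :
  (M_R x y z a)%:R = gapdet (x + 3 * (y + z + a)) z (z + a) y :> rat.
Proof.
rewrite M_R_ballot /gapdet (addnC z y) /detf /detl -det_tr; congr (\det _).
apply/matrixP => i j; have jn : (i < z + y)%N by rewrite [X in (_ < X)%N]addnC.
rewrite !mxE -map_comp (nth_map 0%N) ?size_cat ?size_iota // mxE /gcol.
rewrite nth_cat size_iota /jcol; case: ltnP => iz; rewrite nth_iota //.
- by rewrite addn1 add1n.
- by congr (ballot _ _ _); move: iz; clear; lia.
- by move: jn iz; clear; lia.
Qed.

(** * Product formulas *)

Fixpoint dfact (m : nat) : nat := if m is m'.+2 then (m * dfact m')%N else 1%N.

Lemma dfact_gt0 m : (0 < dfact m)%N.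
Proof.
have : (0 < dfact m)%N /\ (0 < dfact m.+1)%N; last by case.
by elim: m => // m [IH1 IH2]; split=> //; rewrite /= muln_gt0.
Qed.

Lemma dfactSS m : dfact m.+2 = (m.+2 * dfact m)%N.
Proof. by []. Qed.

Lemma dfact_fact m : (dfact m.+1 * dfact m = m.+1`!)%N.
Proof.
by elim: m => // m IH; rewrite factS -IH dfactSS -mulnA (mulnC (dfact m)).
Qed.

Lemma dfact_double m : (dfact (2 * m) = 2 ^ m * m`!)%N.
Proof.
elim: m => // m IH; rewrite mulnS add2n dfactSS IH expnS factS.
by clear IH; nia.
Qed.

Section StepProducts.
Variable g : nat -> nat.
Hypothesis g_gt0 : forall m, (0 < g m)%N.

(* The solution of stepprod (m + k) = g m * stepprod m that is 1 on m < k. *)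
Definition stepprod (k m : nat) : rat := (\prod_(j < m %/ k) g (m - k * j.+1))%:R.

Lemma stepprod_neq0 k m : stepprod k m != 0.
Proof. by rewrite pnatr_eq0 -lt0n prodn_gt0. Qed.

Lemma stepprodD k m : (0 < k)%N -> stepprod k (m + k) = (g m)%:R * stepprod k m.
Proof.
move=> k0; rewrite /stepprod divnDr // divnn k0 addn1 big_ord_recl /= natrM muln1 addnK.
congr (_ * _%:R); apply: eq_bigr => j _; congr g.
by rewrite /bump /= !mulnS; clear; lia.
Qed.

Lemma prod_stepprod k m a : (0 < k)%N ->
  \prod_(i < a) (g (m + k * i))%:R = stepprod k (m + k * a) / stepprod k m.
Proof.
move=> k0; elim: a => [|a IH].
  by rewrite big_ord0 muln0 addn0 divff // stepprod_neq0.
rewrite big_ord_recr /= IH mulnS addnCA [(k + _)%N]addnC stepprodD //.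
by rewrite mulrC mulrA.
Qed.

Lemma prod_stepprod_rev k m a : (0 < k)%N ->
  \prod_(i < a) (g (m + k * (a - i.+1)))%:R = stepprod k (m + k * a) / stepprod k m.
Proof.
by move=> k0; rewrite -prod_stepprod // (reindex_inj rev_ord_inj) /=;
  apply: eq_bigr => i _; rewrite subnSK // subKn // ltnW.
Qed.
End StepProducts.

Notation sfact := (stepprod factorial).
Notation sdfact := (stepprod dfact).

Lemma sfact_neq0 k m : sfact k m != 0.
Proof. exact/stepprod_neq0/fact_gt0. Qed.
Lemma sdfact_neq0 k m : sdfact k m != 0.
Proof. exact/stepprod_neq0/dfact_gt0. Qed.

(** The factorials below [m] are split into those of [m - 1], [m - 3], .. and those of [m - 2],
    [m - 4], ... *)
Lemma sfact1E m : sfact 1 m = sfact 2 m.+1 * sfact 2 m.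
Proof.
elim: m => [|m IH]; first by rewrite /stepprod /= !big_ord0 mulr1.
have -> : sfact 1 m.+1 = m`!%:R * sfact 1 m by rewrite -stepprodD ?addn1.
have -> : sfact 2 m.+2 = m`!%:R * sfact 2 m by rewrite -stepprodD ?addn2.
by rewrite IH mulrCA mulrC.
Qed.

Lemma sfact3D m : sfact 3 (m + 3) = m`!%:R * sfact 3 m.
Proof. exact: stepprodD. Qed.
Lemma sdfact3D m : sdfact 3 (m + 3) = (dfact m)%:R * sdfact 3 m.
Proof. exact: stepprodD. Qed.

(* All three terms of the recurrences below are products f P * f Q of two
   values of a product f; cross compares two of these terms factor by factor. *)
Definition cross (a1 a2 a3 a4 c : rat) := a3 * a4 = c * (a1 * a2).

Lemma crossM a1 a2 a3 a4 c b1 b2 b3 b4 d : cross a1 a2 a3 a4 c -> cross b1 b2 b3 b4 d ->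
  cross (a1 * b1) (a2 * b2) (a3 * b3) (a4 * b4) (c * d).
Proof. by rewrite /cross => ha hb; rewrite mulrACA ha hb; ring. Qed.

Lemma crossV a1 a2 a3 a4 c : cross a1 a2 a3 a4 c -> cross a1^-1 a2^-1 a3^-1 a4^-1 c^-1.
Proof. by rewrite /cross => h; rewrite -!invfM h. Qed.

Definition same2 (m1 m2 m3 m4 : nat) := (m3 = m1 /\ m4 = m2) \/ (m3 = m2 /\ m4 = m1).

Lemma cross_same (f : nat -> rat) m1 m2 m3 m4 : same2 m1 m2 m3 m4 ->
  cross (f m1) (f m2) (f m3) (f m4) 1.
Proof. by case=> -[-> ->]; rewrite /cross mul1r // mulrC. Qed.

(** One step of [stepprod] leaves [n.+1]! against [n]!. *)
Lemma cross_sfact n k m1 m2 m3 m4 : (0 < k)%N -> same2 n.+1 (n + k) m1 m2 ->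
  same2 n (n.+1 + k) m3 m4 -> cross (sfact k m1) (sfact k m2) (sfact k m3) (sfact k m4) n.+1%:R.
Proof.
move=> k0 h1 h2; have : sfact k n * sfact k (n.+1 + k) = n.+1%:R * (sfact k n.+1 * sfact k (n + k)).
  by rewrite !stepprodD // factS natrM; ring.
by case: h1 h2 => -[-> ->] [] [-> ->] // E; rewrite /cross;
  rewrite ?(mulrC (sfact k (n.+1 + k))) E ?(mulrC (sfact k (n + k))).
Qed.

Lemma cross_sfactV n k m1 m2 m3 m4 : (0 < k)%N -> same2 n.+1 (n + k) m3 m4 ->
  same2 n (n.+1 + k) m1 m2 -> cross (sfact k m1) (sfact k m2) (sfact k m3) (sfact k m4) n.+1%:R^-1.
Proof.
move=> k0 h1 h2; have := cross_sfact k0 h1 h2; rewrite /cross => ->.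
by rewrite mulKf // pnatr_eq0.
Qed.

(* With e + 2 = w + s + 3 y, this is the product over 1 <= i <= y of
     (V - 3 y - 3 i + 2)! (i - 1)! (e + s + 1 - 2 i)! (e - s + 2 - 2 i)!
     / ((e - s + 2 - 3 i)! (e + 1 - i)! (s + 2 i - 2)!)
   times the product over 1 <= i <= 2 y of (V - 3 i)!! / (V - 2 y - 2 i + 1)!,
   where V = 2 e + s + 1 = u + 6 y. *)
Definition consprod (s w y : nat) : rat := let u := (2 * w + 3 * s - 3)%N in
  sfact 3 (u + 3 * y + 2) * (sfact 3 (u + 2))^-1 * sfact 1 y
  * sfact 2 (w + 2 * s + 3 * y - 1) * (sfact 2 (w + 2 * s + y - 1))^-1
  * sfact 2 (w + 3 * y) * (sfact 2 (w + y))^-1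
  * sfact 3 w * (sfact 3 (w + 3 * y))^-1
  * sfact 1 (w + s + 2 * y - 1) * (sfact 1 (w + s + 3 * y - 1))^-1
  * sfact 2 s * (sfact 2 (s + 2 * y))^-1
  * sdfact 3 (u + 6 * y) * (sdfact 3 u)^-1
  * sfact 2 (u + 1) * (sfact 2 (u + 4 * y + 1))^-1.

Lemma consprod_neq0 s w y : consprod s w y != 0.
Proof. by rewrite /consprod !mulf_neq0 ?invr_eq0 ?sfact_neq0 ?sdfact_neq0. Qed.

Ltac same := rewrite /same2; clear; lia.
(** [csame] treats a factor with the same two arguments on both sides. In [cup n] the arguments pass
    from [n + 1], [n + k] to [n], [n + 1 + k], which contributes [n + 1]; [cdown n] is the reverse
    and contributes its inverse. *)
Ltac csame := apply: cross_same; same.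
Ltac cup n := by apply: (@cross_sfact n); [by []|same|same].
Ltac cdown n := by apply: (@cross_sfactV n); [by []|same|same].

(** In the condensation [u] takes the values [U] and [U + 9] in one term, [U + 3] and [U + 6] in the
    other two. This lemma and the next two treat the factors in [u] alone; within [consprod] their
    three ratios cancel. *)
Lemma cross_sfact3 U m1 m2 m3 m4 : same2 (U + 2) (U + 11) m1 m2 -> same2 (U + 5) (U + 8) m3 m4 ->
  cross (sfact 3 m1) (sfact 3 m2) (sfact 3 m3) (sfact 3 m4) ((U + 2)`!%:R / (U + 8)`!%:R).
Proof.
have E : sfact 3 (U + 5) * sfact 3 (U + 8) = (U + 2)`!%:R / (U + 8)`!%:R * (sfact 3 (U + 2) * sfact 3 (U + 11)).
  rewrite (_ : U + 5 = U + 2 + 3)%N; last by clear; lia.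
  rewrite (_ : U + 11 = U + 8 + 3)%N; last by clear; lia.
  by rewrite !sfact3D; field; rewrite fact_neq0.
by case=> -[-> ->] [] [-> ->]; rewrite /cross ?(mulrC (sfact 3 (U + 8))) E ?(mulrC (sfact 3 (U + 11))).
Qed.

Lemma cross_sdfact3 U m1 m2 m3 m4 : same2 U (U + 9) m1 m2 -> same2 (U + 3) (U + 6) m3 m4 ->
  cross (sdfact 3 m1) (sdfact 3 m2) (sdfact 3 m3) (sdfact 3 m4) (((U + 2) * (U + 4) * (U + 6))%:R)^-1.
Proof.
have E : sdfact 3 (U + 3) * sdfact 3 (U + 6) = (((U + 2) * (U + 4) * (U + 6))%:R)^-1 * (sdfact 3 U * sdfact 3 (U + 9)).
  rewrite (_ : U + 9 = U + 6 + 3)%N; last by clear; lia.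
  rewrite !sdfact3D.
  rewrite (_ : dfact (U + 6) = (U + 2) * (U + 4) * (U + 6) * dfact U)%N; last first.
    by rewrite !addnS addn0 !dfactSS; clear; nia.
  rewrite natrM; field; rewrite -!natrD -?natrM ?pnatr_eq0; clear; lia.
by case=> -[-> ->] [] [-> ->]; rewrite /cross ?(mulrC (sdfact 3 (U + 6))) E ?(mulrC (sdfact 3 (U + 9))).
Qed.

Lemma cross_sfact2 U m1 m2 m3 m4 : same2 (U + 1) (U + 10) m1 m2 -> same2 (U + 4) (U + 7) m3 m4 ->
  cross (sfact 2 m1) (sfact 2 m2) (sfact 2 m3) (sfact 2 m4)
    (((U + 2) * (U + 4) * (U + 6) )%:R^-1 * ((U + 2)`!%:R / (U + 8)`!%:R)).
Proof.
have E : sfact 2 (U + 4) * sfact 2 (U + 7) = (((U + 2) * (U + 4) * (U + 6) )%:R^-1 * ((U + 2)`!%:R / (U + 8)`!%:R))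
   * (sfact 2 (U + 1) * sfact 2 (U + 10)).
  have t m : sfact 2 m.+2 = m`!%:R * sfact 2 m by rewrite -stepprodD ?addn2.
  rewrite (_ : U + 10 = (U + 4).+2.+2.+2)%N; last by clear; lia.
  rewrite (_ : U + 7 = (U + 1).+2.+2.+2)%N; last by clear; lia.
  rewrite !t (_ : (U + 4).+2.+2 = U + 8)%N; last by clear; lia.
  rewrite !addnS !addn0 !factS !natrM -!natr1.
  have f0 := fact_neq0 U; field.
  by rewrite f0 !natr1 !pnatr_eq0.
by case=> -[-> ->] [] [-> ->]; rewrite /cross ?(mulrC (sfact 2 (U + 7))) E ?(mulrC (sfact 2 (U + 10))).
Qed.

(** In terms of [w], where [e + 2 = w + s + 3 y], the determinants of the condensation have
    parameter [w] or [w + 3]. *)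
Lemma consprod_rec s w y :
  consprod s.+1 w y.+2 * consprod s.+2 (w + 3) y =
  consprod s.+1 (w + 3) y.+1 * consprod s.+2 w y.+1 - consprod s.+3 w y.+1 * consprod s (w + 3) y.+1.
Proof.
pose U := (2 * w + 3 * s)%N.
have [ca [ha [cb hb hab]]] : exists ca, cross (consprod s.+1 w y.+2) (consprod s.+2 (w + 3) y)
     (consprod s.+1 (w + 3) y.+1) (consprod s.+2 w y.+1) ca /\
   exists2 cb, cross (consprod s.+1 w y.+2) (consprod s.+2 (w + 3) y)
     (consprod s.+3 w y.+1) (consprod s (w + 3) y.+1) cb & ca - cb = 1.
  (* The ratios [ca] and [cb] are left open and assembled by [crossM], from the last factor of
     [consprod] to the first. What remains is the rational identity [ca - cb = 1]. *)
  eexists; split; last eexists.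
  - rewrite /consprod.
    apply: crossM; last by apply: crossV; cup (U + 4 * y + 8)%N.
    apply: crossM; last by apply: (@cross_sfact2 U); rewrite /U; same.
    apply: crossM; last by apply: crossV; apply: (@cross_sdfact3 U); rewrite /U; same.
    apply: crossM; last by csame.
    apply: crossM; last by apply: crossV; cdown (s + 2 * y + 2)%N.
    apply: crossM; last by csame.
    apply: crossM; last by apply: crossV; csame.
    apply: crossM; last by cup (w + s + 2 * y + 3)%N.
    apply: crossM; last by apply: crossV; csame.
    apply: crossM; last by csame.
    apply: crossM; last by apply: crossV; cup (w + y + 1)%N.
    apply: crossM; last by csame.
    apply: crossM; last by apply: crossV; cdown (w + 2 * s + y + 3)%N.
    apply: crossM; last by csame.
    apply: crossM; last by cdown y.
    apply: crossM; last by apply: crossV; apply: (@cross_sfact3 U); rewrite /U; same.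
    csame.
  - rewrite /consprod.
    apply: crossM; last by apply: crossV; cup (U + 4 * y + 8)%N.
    apply: crossM; last by apply: (@cross_sfact2 U); rewrite /U; same.
    apply: crossM; last by apply: crossV; apply: (@cross_sdfact3 U); rewrite /U; same.
    apply: crossM; last by csame.
    apply: crossM; last by apply: crossV; csame.
    apply: crossM; last by cup s.
    apply: crossM; last by apply: crossV; cdown (w + s + 3 * y + 4)%N.
    apply: crossM; last by csame.
    apply: crossM; last by apply: crossV; csame.
    apply: crossM; last by csame.
    apply: crossM; last by apply: crossV; cup (w + y + 1)%N.
    apply: crossM; last by csame.
    apply: crossM; last by apply: crossV; csame.
    apply: crossM; last by cup (w + 2 * s + 3 * y + 5)%N.
    apply: crossM; last by cdown y.
    apply: crossM; last by apply: crossV; apply: (@cross_sfact3 U); rewrite /U; same.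
    csame.
  have q0 : ((U + 2) * (U + 4) * (U + 6))%:R != 0 :> rat by rewrite pnatr_eq0; clear; lia.
  have f2 := fact_neq0 (U + 2); have f8 := fact_neq0 (U + 8).
  move: (((U + 2) * (U + 4) * (U + 6))%:R) ((U + 2)`!%:R) ((U + 8)`!%:R) q0 f2 f8 => q f g q0 f0 g0.
  rewrite /U -!natr1 !(natrM, natrD); field.
  by rewrite f0 g0 q0 -!natrM -!natrD !natr1 !pnatr_eq0.
move: ha hb; rewrite /cross => -> ->.
by rewrite -mulrBl hab mul1r.
Qed.

Lemma sfactD k m : (0 < k)%N -> sfact k (m + k) = m`!%:R * sfact k m.
Proof. exact: stepprodD. Qed.

Lemma sfact0 k : sfact k 0 = 1.
Proof. by rewrite /stepprod div0n big_ord0. Qed.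

Lemma sfact_small k m : (m < k)%N -> sfact k m = 1.
Proof. by move=> mk; rewrite /stepprod divn_small // big_ord0. Qed.

Local Opaque stepprod.

Lemma sfact2S m : sfact 2 m.+2 = m`!%:R * sfact 2 m.
Proof. by rewrite -stepprodD ?addn2. Qed.

(** The factorials on the two sides pair up with quotients [(2 i)! / (2 i - 1)! = 2 i]. *)
Lemma sfact2_double p : sfact 2 (2 * p).+2 = (2 ^ p * p`!)%:R * sfact 2 (2 * p).+1.
Proof.
elim: p => [|p IH]; first by rewrite muln0 sfact2S !sfact_small // mulr1.
rewrite sfact2S mulnS add2n {}IH (sfact2S (2 * p).+1) expnS !factS !natrM.
rewrite (_ : (2 * p).+2%:R = 2%:R * p.+1%:R) -?natrM ?mulnS //; ring.
Qed.

Lemma consprod_y0 s w : consprod s w 0 = 1.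
Proof.
rewrite /consprod !muln0 !addn0 sfact0; field.
by rewrite !sfact_neq0 !sdfact_neq0.
Qed.

Lemma fact_dfact m : m.+1`!%:R = (dfact m.+1)%:R * (dfact m)%:R :> rat.
Proof. by rewrite -natrM dfact_fact. Qed.

Lemma dfact_neq0 m : (dfact m)%:R != 0 :> rat.
Proof. by rewrite pnatr_eq0 -lt0n dfact_gt0. Qed.

Lemma consprod_y1 s w : (3 <= 2 * w + 3 * s)%N -> consprod s w 1 = ballot s 0 (w + s + 1).
Proof.
move=> h; have [u uE] : exists u, (2 * w + 3 * s = u + 3)%N.
  by exists (2 * w + 3 * s - 3)%N; rewrite subnK.
rewrite /consprod uE addnK /ballot leq0n subn0 !muln1.
rewrite (_ : u + 3 + 2 = u + 2 + 3)%N ?(sfactD (u + 2)) //; last by clear; lia.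
rewrite (_ : w + 2 * s + 3 - 1 = w + 2 * s + 2)%N; last by clear; lia.
rewrite (_ : w + 2 * s + 1 - 1 = w + 2 * s)%N; last by clear; lia.
rewrite (sfactD (w + 2 * s)) // (_ : w + 3 = w + 1 + 2)%N; last by clear; lia.
rewrite (sfactD (w + 1)) // (_ : w + 1 + 2 = w + 3)%N; last by clear; lia.
rewrite (sfactD w) // (_ : w + s + 2 - 1 = w + s + 1)%N; last by clear; lia.
rewrite (_ : w + s + 3 - 1 = w + s + 1 + 1)%N; last by clear; lia.
rewrite (sfactD (w + s + 1)) // (sfactD s) //.
rewrite (_ : u + 6 = u + 3 + 3)%N; last by clear; lia.
rewrite !sdfact3D (_ : u + 4 + 1 = u + 1 + 2 + 2)%N; last by clear; lia.
rewrite (sfactD (u + 1 + 2)) // (sfactD (u + 1)) //.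
rewrite (_ : sfact 1 1 = 1); last by rewrite (sfactD 0) // sfact0 mulr1.
rewrite (_ : s + (w + s + 1) - 1 = w + 2 * s)%N; last by clear; lia.
have f1 : (u + 1)`!%:R = (dfact (u + 1))%:R * (dfact u)%:R :> rat by rewrite addn1 fact_dfact.
have f2 : (u + 2)`!%:R = (dfact (u + 2))%:R * (dfact (u + 1))%:R :> rat.
  by rewrite addn2 fact_dfact addn1.
have f3 : (u + 1 + 2)`!%:R = (dfact (u + 3))%:R * (dfact (u + 2))%:R :> rat.
  have -> : (u + 1 + 2 = (u + 2).+1)%N by clear; lia.
  by rewrite fact_dfact addn2 addn3.
have g1 : (w + 1)`!%:R = (w + 1)%:R * w`!%:R :> rat by rewrite addn1 factS natrM.
rewrite f1 f2 f3 g1; clear f1 f2 f3 g1.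
have := dfact_neq0 u; move: ((dfact u)%:R : rat) => d0.
have := dfact_neq0 (u + 1); move: ((dfact (u + 1))%:R : rat) => d1.
have := dfact_neq0 (u + 2); move: ((dfact (u + 2))%:R : rat) => d2.
have := dfact_neq0 (u + 3); move: ((dfact (u + 3))%:R : rat) => d3.
have := sfact_neq0 3 (u + 2); move: (sfact 3 (u + 2)) => t1.
have := sfact_neq0 2 (w + 2 * s); move: (sfact 2 (w + 2 * s)) => t2.
have := sfact_neq0 2 (w + 1); move: (sfact 2 (w + 1)) => t3.
have := sfact_neq0 3 w; move: (sfact 3 w) => t4.
have := sfact_neq0 1 (w + s + 1); move: (sfact 1 (w + s + 1)) => t5.
have := sfact_neq0 2 s; move: (sfact 2 s) => t6.
have := sdfact_neq0 3 u; move: (sdfact 3 u) => t7.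
have := sfact_neq0 2 (u + 1); move: (sfact 2 (u + 1)) => t8.
have := fact_neq0 w; move: (w`!%:R : rat) => g1.
have := fact_neq0 s; move: (s`!%:R : rat) => g2.
have := fact_neq0 (w + s + 1); move: ((w + s + 1)`!%:R : rat) => g3.
move: ((w + 2 * s)`!%:R : rat) => g4.
move=> n1 n2 n3 n4 n5 n6 n7 n8 n9 n10 n11 n12 n13 n14 n15.
rewrite !natrD; field.
by rewrite n1 n2 n3 n4 n5 n6 n7 n8 n9 n10 n11 n12 n13 n14 n15.
Qed.

Lemma consprodE s w y a1 a2 a3 a4 a5 a6 a7 a8 a9 a10 a11 a12 a13 a14 :
  (2 * w + 3 * s - 3 + 3 * y + 2 = a1)%N -> (2 * w + 3 * s - 3 + 2 = a2)%N ->
  (w + 2 * s + 3 * y - 1 = a3)%N -> (w + 2 * s + y - 1 = a4)%N ->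
  (w + 3 * y = a5)%N -> (w + y = a6)%N -> (w + 3 * y = a7)%N ->
  (w + s + 2 * y - 1 = a8)%N -> (w + s + 3 * y - 1 = a9)%N -> (s + 2 * y = a10)%N ->
  (2 * w + 3 * s - 3 + 6 * y = a11)%N -> (2 * w + 3 * s - 3 = a12)%N ->
  (2 * w + 3 * s - 3 + 1 = a13)%N -> (2 * w + 3 * s - 3 + 4 * y + 1 = a14)%N ->
  consprod s w y = sfact 3 a1 * (sfact 3 a2)^-1 * sfact 1 y * sfact 2 a3 * (sfact 2 a4)^-1 * sfact 2 a5 * (sfact 2 a6)^-1
  * sfact 3 w * (sfact 3 a7)^-1 * sfact 1 a8 * (sfact 1 a9)^-1 * sfact 2 s * (sfact 2 a10)^-1
  * sdfact 3 a11 * (sdfact 3 a12)^-1 * sfact 2 a13 * (sfact 2 a14)^-1.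
Proof. by do 14!move=> <-. Qed.

Lemma consprod_s0 v y : consprod 0 (v + 2) y.+1 = consprod 1 (v + 2) y.
Proof.
have R1 : sfact 3 (2 * v + 6) = (2 * v + 3)`!%:R * sfact 3 (2 * v + 3).
  by rewrite -sfactD //; congr (sfact 3); clear; lia.
have R2 : sfact 1 y.+1 = y`!%:R * sfact 1 y by rewrite -sfactD ?addn1.
have R3 : sfact 2 (v + 3 * y + 4) = (v + 3 * y + 2)`!%:R * sfact 2 (v + 3 * y + 2).
  by rewrite -sfactD //; congr (sfact 2); clear; lia.
have R3' : sfact 2 (v + 3 * y + 5) = (v + 3 * y + 3)`!%:R * sfact 2 (v + 3 * y + 3).
  by rewrite -sfactD //; congr (sfact 2); clear; lia.
have R4 : sfact 3 (v + 3 * y + 5) = (v + 3 * y + 2)`!%:R * sfact 3 (v + 3 * y + 2).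
  by rewrite -sfactD //; congr (sfact 3); clear; lia.
have R5 : sfact 1 (v + 2 * y + 3) = (v + 2 * y + 2)`!%:R * sfact 1 (v + 2 * y + 2).
  by rewrite -sfactD //; congr (sfact 1); clear; lia.
have R5' : sfact 1 (v + 3 * y + 4) = (v + 3 * y + 3)`!%:R * ((v + 3 * y + 2)`!%:R * sfact 1 (v + 3 * y + 2)).
  rewrite -(sfactD (v + 3 * y + 2)) // (_ : v + 3 * y + 2 + 1 = v + 3 * y + 3)%N; last by clear; lia.
  by rewrite -sfactD //; congr (sfact 1); clear; lia.
have R6 : sfact 2 (2 * y + 2) = 2 ^+ y * y`!%:R * sfact 2 (2 * y + 1).
  by rewrite addn2 sfact2_double addn1 natrM natrX.
have R7 : sdfact 3 (2 * v + 6 * y + 7) = 2 ^+ y * 2 ^+ (v + 2 * y + 2) * (v + 3 * y + 2)`!%:R * sdfact 3 (2 * v + 6 * y + 4).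
  rewrite (_ : 2 * v + 6 * y + 7 = 2 * (v + 3 * y + 2) + 3)%N; last by clear; lia.
  rewrite sdfact3D dfact_double natrM natrX -exprD; congr (_ ^+ _ * _ * sdfact 3 _); clear; lia.
have R7' : sdfact 3 (2 * v + 4) = (dfact (2 * v + 1))%:R * sdfact 3 (2 * v + 1).
  by rewrite -sdfact3D; congr (sdfact 3); clear; lia.
have R8 : sfact 2 (2 * v + 4 * y + 6) = 2 ^+ (v + 2 * y + 2) * (v + 2 * y + 2)`!%:R * sfact 2 (2 * v + 4 * y + 5).
  rewrite -natrX -natrM (_ : 2 * v + 4 * y + 5 = (2 * (v + 2 * y + 2)).+1)%N; last by clear; lia.
  by rewrite -sfact2_double; congr (sfact 2); clear; lia.
have R9 : sfact 2 (2 * v + 5) = (2 * v + 3)`!%:R * ((dfact (2 * v + 1))%:R * sfact 2 (2 * v + 2)).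
  rewrite (_ : 2 * v + 5 = (2 * v + 3).+2)%N ?sfact2S; last by clear; lia.
  congr (_ * _); have := sfact2_double v.+1; rewrite -dfact_double sfact2S.
  rewrite (_ : 2 * v.+1 = (2 * v + 1).+1)%N; last by clear; lia.
  rewrite fact_dfact -mulrA => /(mulfI (dfact_neq0 _)).
  have -> : (2 * v + 3 = (2 * v + 1).+2)%N by clear; lia.
  have -> : (2 * v + 2 = (2 * v + 1).+1)%N by clear; lia.
  by move=> ->.
rewrite (@consprodE 0 (v + 2) y.+1 (2 * v + 3 * y + 6) (2 * v + 3) (v + 3 * y + 4) (v + y + 2)
  (v + 3 * y + 5) (v + y + 3) (v + 3 * y + 5) (v + 2 * y + 3) (v + 3 * y + 4) (2 * y + 2)
  (2 * v + 6 * y + 7) (2 * v + 1) (2 * v + 2) (2 * v + 4 * y + 6)); try (clear; lia).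
rewrite (@consprodE 1 (v + 2) y (2 * v + 3 * y + 6) (2 * v + 6) (v + 3 * y + 3) (v + y + 3)
  (v + 3 * y + 2) (v + y + 2) (v + 3 * y + 2) (v + 2 * y + 2) (v + 3 * y + 2) (2 * y + 1)
  (2 * v + 6 * y + 4) (2 * v + 4) (2 * v + 5) (2 * v + 4 * y + 5)); try (clear; lia).
rewrite R1 R2 R3 R3' R4 R5 R5' R6 R7 R7' R8 R9 (@sfact_small 2 0) // (@sfact_small 2 1) //.
have p1 : 2 ^+ y != 0 :> rat by rewrite expf_neq0.
have p2 : 2 ^+ (v + 2 * y + 2) != 0 :> rat by rewrite expf_neq0.
field.
by rewrite p1 p2 !sfact_neq0 !sdfact_neq0 !fact_neq0 !dfact_neq0.
Qed.

(** Condensation expresses order [y + 2] through [y + 1] and [y], so two consecutive orders are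
    carried. The lower bound keeps [u] in [consprod] from being truncated. *)
Lemma consdetE s w e y : (e + 2 = w + s + 3 * y)%N -> (3 <= 2 * w + 3 * s)%N ->
  consdet s e y = consprod s w y.
Proof.
have : forall y, (forall s w e, (e + 2 = w + s + 3 * y)%N -> (3 <= 2 * w + 3 * s)%N ->
         consdet s e y = consprod s w y) /\
    (forall s w e, (e + 2 = w + s + 3 * y.+1)%N -> (3 <= 2 * w + 3 * s)%N ->
         consdet s e y.+1 = consprod s w y.+1).
  elim=> [|{}y [IH0 IH1]].
    split=> {}s {}w {}e E h; first by rewrite consdet0 consprod_y0.
    by rewrite consdet1 consprod_y1 //; congr ballot; move: E; clear; lia.
  split=> // -[|{}s] {}w {}e E h.
    have [v wE] : exists v, w = (v + 2)%N by exists (w - 2)%N; move: h; clear; lia.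
    rewrite consdet_s0; last by move: E; clear; lia.
    rewrite wE consprod_s0 -wE; apply: IH1; move: E h; clear; lia.
  have C0 : consdet s.+2 e.-2 y = consprod s.+2 (w + 3) y by apply: IH0; move: E h; clear; lia.
  have nz : consdet s.+2 e.-2 y != 0 by rewrite C0 consprod_neq0.
  apply: (mulIf (consprod_neq0 s.+2 (w + 3) y)); rewrite consprod_rec -C0 consdet_rec //.
  congr (_ * _ - _ * _); apply: IH1; move: E h; clear; lia.
by move=> /(_ y)[+ _]; apply.
Qed.

(** The second product of [P1], telescoped: the ratio of the number of tilings to the one for
    [x + 3 a] and no removed triangle. *)
Definition gapfactor (x y z a : nat) : rat :=
  sfact 1 (y + z + a) * sfact 1 (z) * (sfact 1 (y + z))^-1
  * (sfact 1 (z + a))^-1 * sfact 2 (x + 3 * y + 2 * z + 4 * a + 1) * sfact 2 (x + y + 2 * z + 2 * a + 1)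
  * (sfact 2 (x + 3 * y + 2 * z + 2 * a + 1))^-1 * (sfact 2 (x + y + 2 * z + 4 * a + 1))^-1 * sfact 2 (x + y + 2 * a)
  * sfact 3 (x) * (sfact 2 (x + y))^-1 * (sfact 3 (x + 3 * a))^-1
  * sfact 3 (x + 3 * y + 3 * a) * sfact 2 (x + 3 * y) * (sfact 3 (x + 3 * y))^-1
  * (sfact 2 (x + 3 * y + 2 * a))^-1 * (sfact 1 (y + a))^-1 * sfact 1 (y)
  * sfact 1 (a) * (sfact 2 (2 * y + 2 * z + 2 * a + 1))^-1 * (sfact 2 (2 * z + 1))^-1
  * sfact 2 (2 * y + 2 * z + 1) * sfact 2 (2 * z + 2 * a + 1) * (sfact 1 (x + 2 * y + z + 3 * a))^-1
  * (sfact 1 (x + y + z + 2 * a))^-1 * sfact 1 (x + 2 * y + z + 2 * a) * sfact 1 (x + y + z + 3 * a).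

Lemma gapfactor_neq0 x y z a : gapfactor x y z a != 0.
Proof. by rewrite /gapfactor !mulf_neq0 ?invr_eq0 ?sfact_neq0. Qed.

Lemma gapfactor_rec x y z a :
  gapfactor (x + 3) y.+1 z.+1 a * gapfactor x y.+1 z a.+2 - gapfactor x y.+1 z.+1 a.+1 * gapfactor (x + 3) y.+1 z a.+1
  + gapfactor x y.+2 z a.+1 * gapfactor (x + 3) y z.+1 a.+1 = 0.
Proof.
have [ca [ha [cb hb hab]]] : exists ca, cross (gapfactor x y.+1 z.+1 a.+1) (gapfactor (x + 3) y.+1 z a.+1)
     (gapfactor (x + 3) y.+1 z.+1 a) (gapfactor x y.+1 z a.+2) ca /\
   exists2 cb, cross (gapfactor x y.+1 z.+1 a.+1) (gapfactor (x + 3) y.+1 z a.+1)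
     (gapfactor x y.+2 z a.+1) (gapfactor (x + 3) y z.+1 a.+1) cb & ca + cb = 1.
  eexists; split; last eexists.
  - rewrite /gapfactor.
    apply: crossM; last by csame.
    apply: crossM; last by cdown (x + 2 * y + z + 2 * a + 5)%N.
    apply: crossM; last by apply: crossV; cdown (x + y + z + 2 * a + 4)%N.
    apply: crossM; last by apply: crossV; csame.
    apply: crossM; last by csame.
    apply: crossM; last by csame.
    apply: crossM; last by apply: crossV; csame.
    apply: crossM; last by apply: crossV; csame.
    apply: crossM; last by cup (a)%N.
    apply: crossM; last by csame.
    apply: crossM; last by apply: crossV; cup (y + a + 1)%N.
    apply: crossM; last by apply: crossV; cdown (x + 3 * y + 2 * a + 5)%N.
    apply: crossM; last by apply: crossV; csame.
    apply: crossM; last by csame.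
    apply: crossM; last by csame.
    apply: crossM; last by apply: crossV; csame.
    apply: crossM; last by apply: crossV; csame.
    apply: crossM; last by csame.
    apply: crossM; last by cdown (x + y + 2 * a + 3)%N.
    apply: crossM; last by apply: crossV; cup (x + y + 2 * z + 4 * a + 7)%N.
    apply: crossM; last by apply: crossV; csame.
    apply: crossM; last by csame.
    apply: crossM; last by cup (x + 3 * y + 2 * z + 4 * a + 9)%N.
    apply: crossM; last by apply: crossV; csame.
    apply: crossM; last by apply: crossV; csame.
    apply: crossM; last by csame.
    by csame.
  - rewrite /gapfactor.
    apply: crossM; last by csame.
    apply: crossM; last by cdown (x + 2 * y + z + 2 * a + 5)%N.
    apply: crossM; last by apply: crossV; csame.
    apply: crossM; last by apply: crossV; cdown (x + 2 * y + z + 3 * a + 6)%N.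
    apply: crossM; last by csame.
    apply: crossM; last by csame.
    apply: crossM; last by apply: crossV; csame.
    apply: crossM; last by apply: crossV; csame.
    apply: crossM; last by csame.
    apply: crossM; last by cup (y)%N.
    apply: crossM; last by apply: crossV; cup (y + a + 1)%N.
    apply: crossM; last by apply: crossV; csame.
    apply: crossM; last by apply: crossV; csame.
    apply: crossM; last by csame.
    apply: crossM; last by csame.
    apply: crossM; last by apply: crossV; csame.
    apply: crossM; last by apply: crossV; cdown (x + y + 1)%N.
    apply: crossM; last by csame.
    apply: crossM; last by cdown (x + y + 2 * a + 3)%N.
    apply: crossM; last by apply: crossV; cup (x + y + 2 * z + 4 * a + 7)%N.
    apply: crossM; last by apply: crossV; csame.
    apply: crossM; last by cup (x + y + 2 * z + 2 * a + 5)%N.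
    apply: crossM; last by csame.
    apply: crossM; last by apply: crossV; csame.
    apply: crossM; last by apply: crossV; csame.
    apply: crossM; last by csame.
    by csame.
  - rewrite -!natr1 !(natrM, natrD); field.
    by rewrite -!natrM -!natrD !natr1 !pnatr_eq0.
move: ha hb; rewrite /cross => -> ->.
by rewrite addrAC -mulrDl hab mul1r subrr.
Qed.

Lemma gapfactor_y0 x z a : gapfactor x 0 z a = 1.
Proof.
rewrite /gapfactor !muln0 !addn0 !add0n sfact0; field.
by rewrite !sfact_neq0.
Qed.

Lemma gapfactor_a0 x y z : gapfactor x y z 0 = 1.
Proof.
rewrite /gapfactor !muln0 !addn0 sfact0; field.
by rewrite !sfact_neq0.
Qed.

(** For [z = 0] the columns [a + 1] to [a + y] are consecutive, with [s = 2 a + 1]. *)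
Lemma gapfactor_z0 x y a : consprod (2 * a + 1) x y = consprod 1 (x + 3 * a) y * gapfactor x y 0 a.
Proof.
rewrite (@consprodE (2 * a + 1) x y (2 * x + 6 * a + 3 * y + 2) (2 * x + 6 * a + 2) (x + 3 * y + 4 * a + 1)
  (x + y + 4 * a + 1) (x + 3 * y) (x + y) (x + 3 * y) (x + 2 * y + 2 * a) (x + 3 * y + 2 * a)
  (2 * y + 2 * a + 1) (2 * x + 6 * a + 6 * y) (2 * x + 6 * a) (2 * x + 6 * a + 1)
  (2 * x + 6 * a + 4 * y + 1)); try (clear; lia).
rewrite (@consprodE 1 (x + 3 * a) y (2 * x + 6 * a + 3 * y + 2) (2 * x + 6 * a + 2) (x + 3 * y + 3 * a).+1
  (x + y + 3 * a).+1 (x + 3 * y + 3 * a) (x + y + 3 * a) (x + 3 * y + 3 * a) (x + 2 * y + 3 * a)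
  (x + 3 * y + 3 * a) (2 * y + 1) (2 * x + 6 * a + 6 * y) (2 * x + 6 * a) (2 * x + 6 * a + 1)
  (2 * x + 6 * a + 4 * y + 1)); try (clear; lia).
rewrite /gapfactor !muln0 !addn0 sfact0 (sfact1E (x + 3 * y + 3 * a)) (sfact1E (x + y + 3 * a)) (sfact1E (x + y + 2 * a))
  (sfact1E (x + 3 * y + 2 * a)) !(addn1 (_ + 2 * a)) !(@sfact_small 2 1) //; field.
by rewrite !sfact_neq0 !sdfact_neq0.
Qed.

(** The relation is solved for the determinant with [z.+1], [y.+1], [a.+1]; the other five have
    smaller [z], or the same [z] and smaller [y], or the same [z], [y] and smaller [a]. *)
Lemma gapdetE x y z a :
  gapdet (x + 3 * (y + z + a)) z (z + a) y = consprod 1 (x + 3 * a) (z + y) * gapfactor x y z a.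
Proof.
have full x' n : gapdet (x' + 3 * n) 0 0 n = consprod 1 x' n.
  rewrite gapdet_cons; case: n => [|n]; first by rewrite consdet0 consprod_y0.
  by apply: consdetE; clear; lia.
elim: z x y a => [|z IHz] x y a.
  rewrite !add0n addn0 gapdet_cons; case: y => [|y].
    by rewrite consdet0 consprod_y0 gapfactor_y0 mulr1.
  by rewrite -gapfactor_z0; apply: consdetE; clear; lia.
elim: y x a => [|y IHy] x a.
  rewrite gapdet_full gapfactor_y0 mulr1 addn0 -full; congr (gapdet _ _ _ _); clear; lia.
elim: a x => [|a IHa] x.
  rewrite !addn0 ?muln0 ?addn0 gapdet_nogap gapfactor_a0 mulr1 -full; congr (gapdet _ _ _ _); clear; lia.
pose X := (x + 3 * (y.+1 + z.+1 + a.+1))%N; pose b := (z + a).+1.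
(* The first factor depends only on [X] and the order. Each term has one determinant of order
   [z + y + 2] and one of order [z + y + 1], so [P * Q] divides out. *)
have [P PE] : exists P, consprod 1 (x + 3 * a.+1) (z.+1 + y.+1) = P by eexists.
have [Q QE] : exists Q, consprod 1 (x + 3 * a.+2) (z + y.+1) = Q by eexists.
have P0 : P != 0 by rewrite -PE consprod_neq0.
have Q0 : Q != 0 by rewrite -QE consprod_neq0.
have E1 : gapdet X z.+1 b y.+1 = P * gapfactor (x + 3) y.+1 z.+1 a.
  have := IHa (x + 3)%N; have -> : (x + 3 + 3 * (y.+1 + z.+1 + a) = X)%N by rewrite /X; clear; lia.
  have -> : (z.+1 + a = b)%N by rewrite /b; clear; lia.
  have -> : (x + 3 + 3 * a = x + 3 * a.+1)%N by clear; lia.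
  by rewrite PE => ->.
have E2 : gapdet X z b.+1 y.+1 = Q * gapfactor x y.+1 z a.+2.
  have := IHz x y.+1 a.+2; have -> : (x + 3 * (y.+1 + z + a.+2) = X)%N by rewrite /X; clear; lia.
  have -> : (z + a.+2 = b.+1)%N by rewrite /b; clear; lia.
  by rewrite QE => ->.
have E4 : gapdet X z b y.+1 = Q * gapfactor (x + 3) y.+1 z a.+1.
  have := IHz (x + 3)%N y.+1 a.+1; have -> : (x + 3 + 3 * (y.+1 + z + a.+1) = X)%N by rewrite /X; clear; lia.
  have -> : (z + a.+1 = b)%N by rewrite /b; clear; lia.
  have -> : (x + 3 + 3 * a.+1 = x + 3 * a.+2)%N by clear; lia.
  by rewrite QE => ->.
have E5 : gapdet X z b y.+2 = P * gapfactor x y.+2 z a.+1.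
  have := IHz x y.+2 a.+1; have -> : (x + 3 * (y.+2 + z + a.+1) = X)%N by rewrite /X; clear; lia.
  have -> : (z + a.+1 = b)%N by rewrite /b; clear; lia.
  have -> : (z + y.+2 = z.+1 + y.+1)%N by clear; lia.
  by rewrite PE => ->.
have E6 : gapdet X z.+1 b.+1 y = Q * gapfactor (x + 3) y z.+1 a.+1.
  have := IHy (x + 3)%N a.+1; have -> : (x + 3 + 3 * (y + z.+1 + a.+1) = X)%N by rewrite /X; clear; lia.
  have -> : (z.+1 + a.+1 = b.+1)%N by rewrite /b; clear; lia.
  have -> : (x + 3 + 3 * a.+1 = x + 3 * a.+2)%N by clear; lia.
  have -> : (z.+1 + y = z + y.+1)%N by clear; lia.
  by rewrite QE => ->.
rewrite -/X PE (_ : z.+1 + a.+1 = b.+1)%N; last by rewrite /b; clear; lia.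
have nz : gapdet X z.+1 b y.+1 != 0 by rewrite E1 (mulf_neq0 P0 (gapfactor_neq0 _ _ _ _)).
have := gapdet_rec nz; rewrite E1 E2 E4 E5 E6.
have e0 := gapfactor_neq0 (x + 3) y.+1 z a.+1; have := gapfactor_rec x y z a.
move: (gapfactor (x + 3) y.+1 z.+1 a) (gapfactor x y.+1 z a.+2) (gapfactor x y.+1 z.+1 a.+1) => e1 e2 e3.
move: (gapfactor x y.+2 z a.+1) (gapfactor (x + 3) y z.+1 a.+1) (gapdet X z.+1 b.+1 y.+1) => e5 e6 g.
move: (gapfactor (x + 3) y.+1 z a.+1) e0 => e4 e0 R1 R2; apply: (mulIf (mulf_neq0 Q0 e0)).
have -> : g * (Q * e4) = P * Q * (e1 * e2 + e5 * e6) - 0 by rewrite -R2; ring.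
have -> : e1 * e2 + e5 * e6 = e3 * e4 + 0 by rewrite -R1; ring.
ring.
Qed.

(** * Translation into Pochhammer symbols *)

Lemma poch_fact (X : rat) (n : int) (c d : nat) :
  X = c.+1%:R -> n = d%:Z - c%:Z -> poch X n = d`!%:R / c`!%:R.
Proof.
move=> ->; have [cd|dc] := leqP c d.
  rewrite subzn // => -> /=; rewrite -[in d`!](subnKC cd); elim: (d - c)%N => [|k IH].
    by rewrite big_ord0 addn0 divff ?fact_neq0.
  rewrite big_ord_recr /= IH addnS factS natrM -natrD.
  by rewrite addSn mulrC mulrA.
(* For a negative index the symbol is the inverse of [c (c - 1) .. (d + 1)]. *)
have [k kE] : exists k, (c = d + k.+1)%N by exists (c - d).-1; move: dc; clear; lia.
have -> : d%:Z - c%:Z = Negz k by rewrite kE; clear; lia.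
move=> -> /=; rewrite -[RHS]invrK invf_div; congr (_^-1).
have : forall m, (m <= c)%N -> \prod_(j < m) (c.+1%:R - j.+1%:R) = c`!%:R / (c - m)`!%:R :> rat.
  elim=> [_|m IH mc]; first by rewrite big_ord0 subn0 divff ?fact_neq0.
  rewrite big_ord_recr /= IH ?(ltnW mc) // -natrB; last exact: leqW.
  rewrite subSS -(subnSK mc) factS natrM.
  have k0 : (c - m.+1).+1%:R != 0 :> rat by rewrite pnatr_eq0.
  have f0 := fact_neq0 (c - m.+1); move: ((c - m.+1).+1%:R : rat) k0 => q q0.
  by field; rewrite q0 f0.
move=> /(_ k.+1) ->; last by rewrite kE leq_addl.
by rewrite kE addnK.
Qed.

Lemma spoch_dfact (X : rat) (n : int) (c k : nat) :
  X = c.+2%:R -> n = k%:Z -> spoch X n = (dfact (c + 2 * k))%:R / (dfact c)%:R.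
Proof.
move=> -> -> /=; elim: k => [|k IH]; first by rewrite big_ord0 muln0 addn0 divff ?dfact_neq0.
rewrite big_ord_recr /= IH mulnS addnCA add2n dfactSS (natrM _ (c + 2 * k).+2) -natrD !addSn.
by rewrite mulrC mulrA.
Qed.

Lemma consprod1E w n : consprod 1 w n =
  sfact 3 (2 * w + 3 * n + 2) / sfact 3 (2 * w + 2) * sfact 1 n * sfact 1 (w + 2 * n) / sfact 1 (w + n)
  * sfact 3 w / sfact 3 (w + 3 * n) / sfact 2 (2 * n + 1) * sdfact 3 (2 * w + 6 * n) / sdfact 3 (2 * w)
  * sfact 2 (2 * w + 1) / sfact 2 (2 * w + 4 * n + 1).
Proof.
rewrite (@consprodE 1 w n (2 * w + 3 * n + 2) (2 * w + 2) (w + 3 * n).+1 (w + n).+1 (w + 3 * n)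
  (w + n) (w + 3 * n) (w + 2 * n) (w + 3 * n) (2 * n + 1) (2 * w + 6 * n) (2 * w) (2 * w + 1)
  (2 * w + 4 * n + 1)); try (clear; lia).
rewrite (sfact1E (w + 3 * n)) (sfact1E (w + n)) (@sfact_small 2 1) //; field.
by rewrite !sfact_neq0 !sdfact_neq0.
Qed.

Lemma consprod1_prod (w n : nat) (W : rat) : W = (2 * w)%:R ->
  (2 ^+ n)^-1 * \prod_(1 <= i < n.+1)
     (poch (W + 2*i%:R) i%:Z * spoch (W + 4*i%:R + 1) (i%:Z - 1)
      / (poch i%:R i%:Z * spoch (W + 2*i%:R + 1) (i%:Z - 1))) = consprod 1 w n.
Proof.
move=> WE; elim: n => [|n IH]; first by rewrite big_geq // consprod_y0 expr0 invr1 mulr1.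
rewrite big_nat_recr // exprS invfM.
have aux (p q r F : rat) : p * q * (r * F) = (q * r) * (p * F) by ring.
rewrite aux IH {IH aux}.
rewrite (@poch_fact (W + 2 * n.+1%:R) n.+1 (2 * w + 2 * n + 1) (2 * w + 3 * n + 2)); first last.
- by clear; lia.
- by rewrite WE -!natr1 !(natrM, natrD); ring.
rewrite (@spoch_dfact (W + 4 * n.+1%:R + 1) (n.+1%:Z - 1) (2 * w + 4 * n + 3) n); first last.
- by clear; lia.
- by rewrite WE -!natr1 !(natrM, natrD); ring.
rewrite (@poch_fact n.+1%:R n.+1 n (2 * n + 1)) //; last by clear; lia.
rewrite (@spoch_dfact (W + 2 * n.+1%:R + 1) (n.+1%:Z - 1) (2 * w + 2 * n + 1) n); first last.
- by clear; lia.
- by rewrite WE -!natr1 !(natrM, natrD); ring.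
have R1 : sfact 3 (2 * w + 3 * n.+1 + 2) = (2 * w + 3 * n + 2)`!%:R * sfact 3 (2 * w + 3 * n + 2).
  by rewrite -sfact3D; congr (sfact 3); clear; lia.
have R2 : sfact 1 n.+1 = n`!%:R * sfact 1 n by rewrite -sfactD ?addn1.
have R3 : sfact 1 (w + 2 * n.+1) = (w + 2 * n + 1)`!%:R * ((w + 2 * n)`!%:R * sfact 1 (w + 2 * n)).
  by rewrite -sfactD // -sfactD //; congr (sfact 1); clear; lia.
have R4 : sfact 1 (w + n.+1) = (w + n)`!%:R * sfact 1 (w + n).
  by rewrite -sfactD //; congr (sfact 1); clear; lia.
have R5 : sfact 3 (w + 3 * n.+1) = (w + 3 * n)`!%:R * sfact 3 (w + 3 * n).
  by rewrite -sfact3D; congr (sfact 3); clear; lia.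
have R6 : sfact 2 (2 * n.+1 + 1) = (2 * n + 1)`!%:R * sfact 2 (2 * n + 1).
  by rewrite -sfactD //; congr (sfact 2); clear; lia.
have R7 : sdfact 3 (2 * w + 6 * n.+1) = (dfact (2 * w + 6 * n + 3))%:R *
    (2 ^+ w * (2 ^+ n) ^+ 3 * (w + 3 * n)`!%:R * sdfact 3 (2 * w + 6 * n)).
  have <- : (dfact (2 * w + 6 * n))%:R = 2 ^+ w * (2 ^+ n) ^+ 3 * (w + 3 * n)`!%:R :> rat.
    rewrite (_ : 2 * w + 6 * n = 2 * (w + 3 * n))%N; last by clear; lia.
    by rewrite dfact_double natrM natrX exprD (mulnC 3) exprM.
  by rewrite -!sdfact3D; congr (sdfact 3); clear; lia.
have R8 : sfact 2 (2 * w + 4 * n.+1 + 1) = (2 * w + 4 * n + 3)`!%:R *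
    ((2 * w + 4 * n + 1)`!%:R * sfact 2 (2 * w + 4 * n + 1)).
  rewrite -sfactD // (_ : 2 * w + 4 * n + 1 + 2 = 2 * w + 4 * n + 3)%N; last by clear; lia.
  by rewrite -sfactD //; congr (sfact 2); clear; lia.
(* Odd factorials are split so that the double factorials from the skipped symbols cancel. *)
have F m : (2 * m + 1)`!%:R = (dfact (2 * m + 1))%:R * (2 ^+ m * m`!%:R) :> rat.
  by rewrite addn1 fact_dfact dfact_double natrM natrX.
have q2 : 2 ^+ (2 * n) = (2 ^+ n) ^+ 2 :> rat by rewrite mulnC exprM.
have F1 : (2 * w + 4 * n + 3)`!%:R = (dfact (2 * w + 4 * n + 3))%:R *
    (2 * 2 ^+ w * (2 ^+ n) ^+ 2 * (w + 2 * n + 1)`!%:R) :> rat.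
  rewrite (_ : 2 * w + 4 * n + 3 = 2 * (w + 2 * n + 1) + 1)%N; last by clear; lia.
  by rewrite F (exprD _ (w + 2 * n)) (exprD _ w) q2 expr1; ring.
have F2 : (2 * w + 4 * n + 1)`!%:R = (dfact (2 * w + 4 * n + 1))%:R *
    (2 ^+ w * (2 ^+ n) ^+ 2 * (w + 2 * n)`!%:R) :> rat.
  rewrite (_ : 2 * w + 4 * n + 1 = 2 * (w + 2 * n) + 1)%N; last by clear; lia.
  by rewrite F (exprD _ w) q2.
have F3 : (2 * w + 2 * n + 1)`!%:R = (dfact (2 * w + 2 * n + 1))%:R *
    (2 ^+ w * 2 ^+ n * (w + n)`!%:R) :> rat.
  rewrite (_ : 2 * w + 2 * n + 1 = 2 * (w + n) + 1)%N; last by clear; lia.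
  by rewrite F exprD.
have -> : (2 * w + 4 * n + 3 + 2 * n = 2 * w + 6 * n + 3)%N by clear; lia.
have -> : (2 * w + 2 * n + 1 + 2 * n = 2 * w + 4 * n + 1)%N by clear; lia.
rewrite !consprod1E R1 R2 R3 R4 R5 R6 R7 R8 F1 F2 F3 {R1 R2 R3 R4 R5 R6 R7 R8 F F1 F2 F3 q2}.
have p1 : 2 ^+ w != 0 :> rat by rewrite expf_neq0.
have p2 : 2 ^+ n != 0 :> rat by rewrite expf_neq0.
move: (2 ^+ w : rat) (2 ^+ n : rat) p1 p2 => p q p0 q0.
field.
by rewrite p0 q0 !sfact_neq0 !sdfact_neq0 !fact_neq0 !dfact_neq0.
Qed.

Lemma gapfactor_prod x y z a :
  \prod_(1 <= i < a.+1)
     (poch (z%:R + i%:R) (y%:Z + a%:Z - 2 * i%:Z + 1)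
      * poch (x%:R + y%:R + 2*z%:R + 2*a%:R + 2*i%:R) (2*y%:Z + 2*a%:Z - 4 * i%:Z + 2)
      * poch (x%:R + 3*i%:R - 2) (y%:Z - i%:Z + 1)
      * poch (x%:R + 3*y%:R + 2*i%:R - 1) (i%:Z - 1)
      / (poch i%:R y%:Z
         * poch (y%:R + 2*z%:R + 2*i%:R - 1) (y%:Z + 2*a%:Z - 4 * i%:Z + 3)
         * poch (2*z%:R + 2*i%:R) (y%:Z + 2*a%:Z - 4 * i%:Z + 1)
         * poch (x%:R + y%:R + z%:R + 2*a%:R + i%:R) (y%:Z + a%:Z - 2 * i%:Z + 1)))
  = gapfactor x y z a.
Proof.
(* Each symbol is a quotient of factorials whose arguments rise ([up]) or fall ([dn]) in steps of
   [k] as [i] grows, so each product over [i] is a quotient of two [sfact]. The two progressions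
   starting at [y + 2 z] cancel. *)
rewrite big_add1 [a.+1.-1]/= big_mkord.
pose up k m i : rat := (m + k * i)`!%:R; pose dn k m i : rat := (m + k * (a - i.+1))`!%:R.
rewrite (eq_bigr (fun i : 'I_a =>
   (dn 1%N (z + y)%N i / up 1%N z i) * (dn 2%N (x + 3 * y + 2 * z + 2 * a + 1)%N i / up 2%N (x + y + 2 * z + 2 * a + 1)%N i)
   * (up 2%N (x + y)%N i / up 3%N x i) * (up 3%N (x + 3 * y)%N i / up 2%N (x + 3 * y)%N i)
   / ((up 1%N y i / up 1%N 0%N i) * (dn 2%N (2 * y + 2 * z + 1)%N i / up 2%N (y + 2 * z)%N i)
      * (dn 2%N (y + 2 * z)%N i / up 2%N (2 * z + 1)%N i)
      * (dn 1%N (x + 2 * y + z + 2 * a)%N i / up 1%N (x + y + z + 2 * a)%N i)))); last first.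
  move=> i _; have ia := ltn_ord i; rewrite /up /dn.
  congr (_ * _ * _ * _ / (_ * _ * _ * _)); apply: poch_fact;
    first [by rewrite -!natr1 !(natrD, natrM) -?natr1; ring | by move: ia; clear; lia].
rewrite !(big_split, prodfV) /=.
rewrite /up /dn !(@prod_stepprod factorial fact_gt0) // !(@prod_stepprod_rev factorial fact_gt0) //.
rewrite !mul1n !add0n sfact0 (addnC z y).
have -> : (x + 3 * y + 2 * z + 2 * a + 1 + 2 * a = x + 3 * y + 2 * z + 4 * a + 1)%N by clear; lia.
have -> : (x + y + 2 * z + 2 * a + 1 + 2 * a = x + y + 2 * z + 4 * a + 1)%N by clear; lia.
have -> : (2 * y + 2 * z + 1 + 2 * a = 2 * y + 2 * z + 2 * a + 1)%N by clear; lia.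
have -> : (2 * z + 1 + 2 * a = 2 * z + 2 * a + 1)%N by clear; lia.
have -> : (x + 2 * y + z + 2 * a + a = x + 2 * y + z + 3 * a)%N by clear; lia.
have -> : (x + y + z + 2 * a + a = x + y + z + 3 * a)%N by clear; lia.
rewrite /gapfactor; field.
by rewrite !sfact_neq0.
Qed.

Theorem theorem4p2 (x y z a : nat) :
  ((M_R x y z a)%:R : rat) = P1 x y z a.
Proof.
rewrite M_R_gapdet gapdetE (addnC z) -gapfactor_prod /P1; congr (_ * _).
rewrite -(@consprod1_prod _ _ (2 * x%:R + 6 * a%:R)) // !(natrM, natrD); ring.
Qed.
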